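(* Let $\mathcal{B},\widetilde{\mathcal{B}}$ be finite 2-categories, let $\mathcal{F}:\mathcal{B}\to\widetilde{\mathcal{B}}$ be a biequivalence which is a 2-functor, and let $\widehat{\mathcal{F}}:Z(\mathcal{B})\to Z(\widetilde{\mathcal{B}})$ be the monoidal equivalence associated to $\mathcal{F}$ (described in the context). Then for any 0-cell $B$ of $\mathcal{B}$ there is an isomorphism $$\widehat{\mathcal{F}}(\mathcal{A}d_B)\simeq\mathcal{A}d_{\mathcal{F}(B)}$$ of algebras in $Z(\widetilde{\mathcal{B}})$, where $\mathcal{A}d_B$ and $\mathcal{A}d_{\mathcal{F}(B)}$ are the adjoint algebras of the 0-cells $B$ and $\mathcal{F}(B)$.
   Context: Throughout, $\Bbbk$ is an algebraically closed field; all (hom-)categories are abelian $\Bbbk$-linear and all functors additive $\Bbbk$-linear. 2-categories are strict; $\circ$ is horizontal composition, juxtaposition is vertical composition, $I_A$ is the identity 1-cell of $A$. A left dual of $X\in\mathcal{B}(A,B)$ is a 1-cell ${}^*X\in\mathcal{B}(B,A)$ with 2-cells $\mathrm{ev}_X:X\circ{}^*X\to I_B$, $\mathrm{coev}_X:I_A\to{}^*X\circ X$ satisfying the two triangle (rigidity) identities; a right dual $X^*$ is defined similarly with $X^*\circ X\to I_A$, $I_B\to X\circ X^*$. $\mathcal{B}$ is rigid if every 1-cell has left and right duals. A finite category is one equivalent to finite-dimensional modules over a finite-dimensional $\Bbbk$-algebra. A finite 2-category is a rigid 2-category with all $\mathcal{B}(A,B)$ finite and all $I_A$ simple in $\mathcal{B}(A,A)$.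 A pseudofunctor $(F,\alpha)$ has natural isomorphisms $\alpha_{X,Y}:F(X)\circ F(Y)\to F(X\circ Y)$ and $\phi_A:I_{F(A)}\to F(I_A)$ satisfying the usual axioms; it is a 2-functor if these are identities. A pseudonatural transformation $\chi:F\to G$ consists of 1-cells $\chi^0_A:F(A)\to G(A)$ and invertible 2-cells $\chi_X:G(X)\circ\chi^0_A\to\chi^0_B\circ F(X)$ natural in $X\in\mathcal{B}(A,B)$, with the usual axioms; modifications are as usual, and $\sim$ means isomorphic through an invertible modification. The composite $\theta\circ\sigma$ has $(\theta\circ\sigma)^0_A=\theta^0_A\circ\sigma^0_A$ and $(\theta\circ\sigma)_X=(\mathrm{id}_{\theta^0_B}\circ\sigma_X)(\theta_X\circ\mathrm{id}_{\sigma^0_A})$. A biequivalence is a pseudofunctor $F$ for which there is a pseudofunctor $G$ with $G\circ F$ and $F\circ G$ pseudonaturally equivalent to the identities. Center: objects of $Z(\mathcal{B})$ are pairs $(V,\sigma)$ with 1-cells $V_A\in\mathcal{B}(A,A)$ for each 0-cell $A$ and isomorphisms $\sigma_X:V_B\circ X\to X\circ V_A$ natural in $X\in\mathcal{B}(A,B)$, with $\sigma_{I_A}=\mathrm{id}$ and $\sigma_{X\circ Y}=(\mathrm{id}_X\circ\sigma_Y)(\sigma_X\circ\mathrm{id}_Y)$ for composable $X,Y$. Morphisms $f:(V,\sigma)\to(W,\tau)$ are families $f_A:V_A\to W_A$ with $(\mathrm{id}_X\circ f_A)\sigma_X=\tau_X(f_B\circ\mathrm{id}_X)$. The tensor product is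 $(V\otimes W)_A=V_A\circ W_A$, $(\sigma\otimes\tau)_X=(\sigma_X\circ\mathrm{id}_{W_A})(\mathrm{id}_{V_B}\circ\tau_X)$; the unit is $(I_A)_A$ with identity half-braiding. The functor $\widehat{\mathcal{F}}$: let $\mathcal{G}$ be a quasi-inverse biequivalence, $\chi:\mathcal{F}\circ\mathcal{G}\to\mathrm{Id}_{\widetilde{\mathcal{B}}}$ and $\tau:\mathrm{Id}_{\widetilde{\mathcal{B}}}\to\mathcal{F}\circ\mathcal{G}$ mutually inverse pseudonatural equivalences, and $\omega:\tau\circ\chi\to\mathrm{id}_{\mathcal{F}\circ\mathcal{G}}$ an invertible modification. For $(V,\sigma)\in Z(\mathcal{B})$ set $\widehat{\mathcal{F}}(V)_C=\chi^0_C\circ\mathcal{F}(V_{\mathcal{G}(C)})\circ\tau^0_C$, and for $Y\in\widetilde{\mathcal{B}}(C,D)$ let $\widehat{\mathcal{F}}(\sigma)_Y:\widehat{\mathcal{F}}(V)_D\circ Y\to Y\circ\widehat{\mathcal{F}}(V)_C$ be the composite of $\mathrm{id}\circ(\tau_Y)^{-1}$, then $\mathrm{id}_{\chi^0_D}\circ\mathcal{F}(\sigma_{\mathcal{G}(Y)})\circ\mathrm{id}_{\tau^0_C}$ (preceded by $\alpha$ and followed by $\alpha^{-1}$ when $\mathcal{F}$ is only a pseudofunctor), then $(\chi_Y)^{-1}\circ\mathrm{id}$. The monoidal structure $\widehat{\mathcal{F}}(V)\otimes\widehat{\mathcal{F}}(W)\to\widehat{\mathcal{F}}(V\otimes W)$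 at $C$ is $(\mathrm{id}\circ\alpha_{V_{\mathcal{G}(C)},W_{\mathcal{G}(C)}}\circ\mathrm{id})(\mathrm{id}\circ\omega_C\circ\mathrm{id})$. Adjoint algebra of a 0-cell $B$ of a finite 2-category $\mathcal{B}$: set $\mathcal{L}(A,B)=\int_{X\in\mathcal{B}(A,B)}{}^*X\circ X\in\mathcal{B}(A,A)$ with dinatural maps $\pi^{(A,B)}_X:\mathcal{L}(A,B)\to{}^*X\circ X$. The half-braiding $\sigma^B_X:\mathcal{L}(A,B)\circ X\to X\circ\mathcal{L}(C,B)$, $X\in\mathcal{B}(C,A)$, is the isomorphism with $\pi^{(A,B)}_Y\circ\mathrm{id}_X=(\mathrm{ev}_X\circ\mathrm{id}_{{}^*Y\circ Y\circ X})(\mathrm{id}_X\circ\pi^{(C,B)}_{Y\circ X})\sigma^B_X$ for all $Y\in\mathcal{B}(A,B)$ (using the canonical isomorphism ${}^*(Y\circ X)\simeq{}^*X\circ{}^*Y$). Then $\mathcal{A}d_B=((\mathcal{L}(A,B))_A,\sigma^B)\in Z(\mathcal{B})$, with multiplication $m^B$ and unit $u^B$ determined by $\pi^{(A,B)}_Xm^B_A=(\mathrm{id}_{{}^*X}\circ\mathrm{ev}_X\circ\mathrm{id}_X)(\pi^{(A,B)}_X\circ\pi^{(A,B)}_X)$ and $\pi^{(A,B)}_Xu^B_A=\mathrm{coev}_X$. *)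

(* Defs.v *)
From HB Require Import structures.
From mathcomp Require Import all_boot all_order all_algebra all_field.
From mathcomp Require Import boolp.

Set Implicit Arguments.
Unset Strict Implicit.
Unset Printing Implicit Defensive.

Import GRing.Theory.
Local Open Scope ring_scope.

Record lincat (k : fieldType) := LinCat {
  obj :> Type;
  hom : obj -> obj -> lmodType k;
  idm : forall X, hom X X;
  comp : forall X Y Z, hom Y Z -> hom X Y -> hom X Z;
  compA : forall W X Y Z (h : hom Y Z) (g : hom X Y) (f : hom W X),
    comp h (comp g f) = comp (comp h g) f;
  comp1m : forall X Y (f : hom X Y), comp (idm Y) f = f;
  compm1 : forall X Y (f : hom X Y), comp f (idm X) = f;
  comp_linear_l : forall X Y Z (f : hom X Y),
    linear (fun g : hom Y Z => comp g f);
  comp_linear_r : forall X Y Z (g : hom Y Z),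
    linear (fun f : hom X Y => comp g f)
}.

Arguments idm {k l} X.
Arguments comp {k l X Y Z} g f.

Notation "g • f" := (comp g f) (at level 40, left associativity).

(** An equality of objects, seen as a morphism.  Composing along it is how the
    identifications (X ∘ Y) ∘ Z = X ∘ (Y ∘ Z) and I ∘ X = X = X ∘ I of a strict
    2-category, which are only propositional equalities here, are inserted. *)
Definition eqhom (k : fieldType) (C : lincat k) (X Y : C) (e : X = Y) :
    hom X Y :=
  match e in _ = Z return hom X Z with erefl => idm X end.

Definition comps (k : fieldType) (C : lincat k) (X Y Y' Z : C)
    (g : hom Y' Z) (f : hom X Y) (e : Y = Y') : hom X Z :=
  g • (eqhom e • f).

Definition eqs (k : fieldType) (C : lincat k) (X X' Y Y' : C)
    (f : hom X Y) (g : hom X' Y') (e : X = X') (e' : Y = Y') : Prop :=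
  eqhom e' • f = g • eqhom e.

Record iso (k : fieldType) (C : lincat k) (X Y : C) := Iso {
  fwd :> hom X Y;
  bwd : hom Y X;
  fwdK : bwd • fwd = idm X;
  bwdK : fwd • bwd = idm Y
}.

Section LinCat.
Variables (k : fieldType) (C : lincat k).
Implicit Types X Y Z : C.

Definition is_iso X Y (f : hom X Y) : Prop := exists i : iso X Y, f = i.

Definition is_zero X : Prop := idm X = 0.

Definition mono X Y (f : hom X Y) : Prop :=
  forall Z (g h : hom Z X), f • g = f • h -> g = h.

Definition simple_obj X : Prop :=
  ~ is_zero X /\
  forall Y (f : hom Y X), mono f -> is_zero Y \/ is_iso f.

Fact eqhom_K X Y (e : X = Y) : eqhom (esym e) • eqhom e = idm X.
Proof. by case: Y / e; rewrite comp1m. Qed.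

Fact eqhom_VK X Y (e : X = Y) : eqhom e • eqhom (esym e) = idm Y.
Proof. by case: Y / e; rewrite comp1m. Qed.

Definition iso_eq X Y (e : X = Y) : iso X Y := Iso (eqhom_K e) (eqhom_VK e).

Definition iso_inv X Y (f : iso X Y) : iso Y X := Iso (bwdK f) (fwdK f).

Fact iso_compK X Y Z (g : iso Y Z) (f : iso X Y) :
  (bwd f • bwd g) • (g • f) = idm X.
Proof. by rewrite compA -(compA (bwd f)) fwdK compm1 fwdK. Qed.

Fact iso_compVK X Y Z (g : iso Y Z) (f : iso X Y) :
  (g • f) • (bwd f • bwd g) = idm Z.
Proof. by rewrite compA -(compA g) bwdK compm1 bwdK. Qed.

Definition iso_comp X Y Z (g : iso Y Z) (f : iso X Y) : iso X Z :=
  Iso (iso_compK g f) (iso_compVK g f).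

Definition iso_comps X Y Y' Z (g : iso Y' Z) (f : iso X Y) (e : Y = Y') :
    iso X Z :=
  iso_comp g (iso_comp (iso_eq e) f).

End LinCat.

Record linfunctor (k : fieldType) (C D : lincat k) := LinFunctor {
  fobj :> C -> D;
  fmap : forall X Y : C, hom X Y -> hom (fobj X) (fobj Y);
  fmap_linear : forall X Y : C, linear (@fmap X Y);
  fmap_id : forall X : C, fmap (idm X) = idm (fobj X);
  fmap_comp : forall (X Y Z : C) (g : hom Y Z) (f : hom X Y),
    fmap (g • f) = fmap g • fmap f
}.

Arguments fmap {k C D} l {X Y} f.

Section LinFunctor.
Variable k : fieldType.

Fact linfunctor_id_linear (C : lincat k) (X Y : C) :
  linear (fun f : hom X Y => f).
Proof. by []. Qed.

Definition linfunctor_id (C : lincat k) : linfunctor C C :=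
  @LinFunctor k C C id (fun _ _ f => f) (@linfunctor_id_linear C)
    (fun _ => erefl) (fun _ _ _ _ _ => erefl).

Section Comp.
Variables (C D E : lincat k) (G : linfunctor D E) (F : linfunctor C D).

Let cmap (X Y : C) (f : hom X Y) : hom (G (F X)) (G (F Y)) := fmap G (fmap F f).

Fact linfunctor_comp_linear (X Y : C) : linear (@cmap X Y).
Proof. by move=> a f g; rewrite /cmap !fmap_linear. Qed.

Fact linfunctor_comp_id (X : C) : cmap (idm X) = idm (G (F X)).
Proof. by rewrite /cmap !fmap_id. Qed.

Fact linfunctor_comp_comp (X Y Z : C) (g : hom Y Z) (f : hom X Y) :
  cmap (g • f) = cmap g • cmap f.
Proof. by rewrite /cmap !fmap_comp. Qed.

Definition linfunctor_comp : linfunctor C E :=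
  LinFunctor linfunctor_comp_linear linfunctor_comp_id linfunctor_comp_comp.

End Comp.

Section FmapIso.
Variables (C D : lincat k) (F : linfunctor C D) (X Y : C) (f : iso X Y).

Fact fmap_isoK : fmap F (bwd f) • fmap F f = idm (F X).
Proof. by rewrite -fmap_comp fwdK fmap_id. Qed.

Fact fmap_isoVK : fmap F f • fmap F (bwd f) = idm (F Y).
Proof. by rewrite -fmap_comp bwdK fmap_id. Qed.

Definition fmap_iso : iso (F X) (F Y) := Iso fmap_isoK fmap_isoVK.

End FmapIso.

Definition nat_isomorphic (C D : lincat k) (F G : linfunctor C D) : Prop :=
  exists t : forall X : C, iso (F X) (G X),
    forall (X Y : C) (f : hom X Y), t Y • fmap F f = fmap G f • t X.

Definition equivalent_cat (C D : lincat k) : Prop :=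
  exists (F : linfunctor C D) (G : linfunctor D C),
    nat_isomorphic (linfunctor_comp G F) (linfunctor_id C) /\
    nat_isomorphic (linfunctor_comp F G) (linfunctor_id D).

End LinFunctor.

Record fdmod (k : fieldType) (A : falgType k) := FdMod {
  mcar :> vectType k;
  mact : {linear A -> 'End(mcar)};
  mact1 : mact 1 = \1%VF;
  mactM : forall a b, mact (a * b) = (mact a \o mact b)%VF
}.

Section ModCat.
Variables (k : fieldType) (A : falgType k).

Definition intertwines (M N : fdmod A) : pred 'Hom(M, N) :=
  fun f => `[< forall (a : A) (v : M), f (mact M a v) = mact N a (f v) >].

Fact intertwines_submod (M N : fdmod A) : submod_closed (@intertwines M N).
Proof.
split=> [|c f g /asboolP fH /asboolP gH]; apply/asboolP => a v.
  by rewrite !lfunE linear0.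
by rewrite !lfunE /= !lfunE /= fH gH linearP.
Qed.

HB.instance Definition _ (M N : fdmod A) :=
  GRing.isSubmodClosed.Build k 'Hom(M, N) (@intertwines M N)
    (@intertwines_submod M N).

Record modhom (M N : fdmod A) := ModHom {
  mhom :> 'Hom(M, N);
  mhomP : @intertwines M N mhom
}.

HB.instance Definition _ (M N : fdmod A) := [isSub for @mhom M N].
HB.instance Definition _ (M N : fdmod A) := [Choice of modhom M N by <:].
HB.instance Definition _ (M N : fdmod A) :=
  [SubChoice_isSubLmodule of modhom M N by <:].

Fact modhom_id_subproof (M : fdmod A) : @intertwines M M \1%VF.
Proof. by apply/asboolP => a v; rewrite !id_lfunE. Qed.

Fact modhom_comp_subproof (M N P : fdmod A) (g : modhom N P) (f : modhom M N) :
  @intertwines M P (mhom g \o mhom f)%VF.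
Proof.
apply/asboolP => a v; rewrite !comp_lfunE.
by rewrite (asboolP _ (mhomP f)) (asboolP _ (mhomP g)).
Qed.

Definition modhom_id (M : fdmod A) : modhom M M := ModHom (modhom_id_subproof M).
Definition modhom_comp (M N P : fdmod A) (g : modhom N P) (f : modhom M N) :
  modhom M P := ModHom (modhom_comp_subproof g f).

Fact modhom_compA (M N P Q : fdmod A)
    (h : modhom P Q) (g : modhom N P) (f : modhom M N) :
  modhom_comp h (modhom_comp g f) = modhom_comp (modhom_comp h g) f.
Proof. by apply: val_inj; rewrite /= comp_lfunA. Qed.

Fact modhom_comp1m (M N : fdmod A) (f : modhom M N) :
  modhom_comp (modhom_id N) f = f.
Proof. by apply: val_inj; rewrite /= comp_lfun1l. Qed.

Fact modhom_compm1 (M N : fdmod A) (f : modhom M N) :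
  modhom_comp f (modhom_id M) = f.
Proof. by apply: val_inj; rewrite /= comp_lfun1r. Qed.

Fact modhom_linear_l (M N P : fdmod A) (f : modhom M N) :
  linear (fun g : modhom N P => modhom_comp g f).
Proof.
move=> c g h; apply: val_inj => /=.
by rewrite comp_lfunDl comp_lfunZl.
Qed.

Fact modhom_linear_r (M N P : fdmod A) (g : modhom N P) :
  linear (fun f : modhom M N => modhom_comp g f).
Proof.
move=> c f h; apply: val_inj => /=.
by rewrite comp_lfunDr comp_lfunZr.
Qed.

Definition modcat : lincat k :=
  @LinCat k (fdmod A) (fun M N => modhom M N) modhom_id modhom_comp
    modhom_compA modhom_comp1m modhom_compm1 modhom_linear_l modhom_linear_r.

End ModCat.

(** A [falgType] is a nonzero ring; the second alternative is the category of
    modules over the zero algebra. *)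
Definition finite_cat (k : fieldType) (C : lincat k) : Prop :=
  (exists A : falgType k, equivalent_cat C (modcat A)) \/
  (inhabited C /\ forall X : C, is_zero X).

(** [cells A B] is the category B(A, B): its objects are the 1-cells from A to
    B and its morphisms the 2-cells.  As for functions, [comp1 X Y] is defined
    for X : B -> C and Y : A -> B. *)
Record twocat (k : fieldType) := TwoCat {
  cell0 :> Type;
  cells : cell0 -> cell0 -> lincat k;
  id1 : forall A, cells A A;
  comp1 : forall A B C, cells B C -> cells A B -> cells A C;
  hcomp : forall A B C (X X' : cells B C) (Y Y' : cells A B),
    hom X X' -> hom Y Y' -> hom (comp1 X Y) (comp1 X' Y');
  hcomp_id : forall A B C (X : cells B C) (Y : cells A B),
    hcomp (idm X) (idm Y) = idm (comp1 X Y);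
  hcomp_comp : forall A B C (X X' X'' : cells B C) (Y Y' Y'' : cells A B)
      (f' : hom X' X'') (f : hom X X') (g' : hom Y' Y'') (g : hom Y Y'),
    hcomp (f' • f) (g' • g) = hcomp f' g' • hcomp f g;
  hcomp_linear_l : forall A B C (X X' : cells B C) (Y Y' : cells A B)
      (g : hom Y Y'),
    linear (fun f : hom X X' => hcomp f g);
  hcomp_linear_r : forall A B C (X X' : cells B C) (Y Y' : cells A B)
      (f : hom X X'),
    linear (fun g : hom Y Y' => hcomp f g);
  comp1A : forall A B C D (X : cells C D) (Y : cells B C) (Z : cells A B),
    comp1 X (comp1 Y Z) = comp1 (comp1 X Y) Z;
  comp11X : forall A B (X : cells A B), comp1 (id1 B) X = X;
  comp1X1 : forall A B (X : cells A B), comp1 X (id1 A) = X;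
  hcompA : forall A B C D (X X' : cells C D) (Y Y' : cells B C)
      (Z Z' : cells A B) (f : hom X X') (g : hom Y Y') (h : hom Z Z'),
    eqs (hcomp f (hcomp g h)) (hcomp (hcomp f g) h)
      (comp1A X Y Z) (comp1A X' Y' Z');
  hcomp1f : forall A B (X X' : cells A B) (f : hom X X'),
    eqs (hcomp (idm (id1 B)) f) f (comp11X X) (comp11X X');
  hcompf1 : forall A B (X X' : cells A B) (f : hom X X'),
    eqs (hcomp f (idm (id1 A))) f (comp1X1 X) (comp1X1 X')
}.

Arguments cells {k t} A B.
Arguments id1 {k t} A.
Arguments comp1 {k t A B C} X Y.
Arguments hcomp {k t A B C X X' Y Y'} f g.

Notation "X ∘ Y" := (comp1 X Y) (at level 38, left associativity).
Notation "f ⊚ g" := (hcomp f g) (at level 38, left associativity).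

Ltac strict := by rewrite /= ?(comp1A, comp11X, comp1X1).

(** Vertical composition and equality of 2-cells whose boundaries agree up to
    strict associativity and unitality of 1-cells. *)
Notation "g ⊙ f" := (comps g f ltac:(strict))
  (at level 40, left associativity, only parsing).
Notation "f ≡ g" := (eqs f g ltac:(strict) ltac:(strict))
  (at level 70, no associativity, only parsing).

Section IsoHcomp.
Variables (k : fieldType) (B : twocat k) (a b c : B).
Variables (X X' : cells b c) (Y Y' : cells a b) (f : iso X X') (g : iso Y Y').

Fact iso_hcompK : (bwd f ⊚ bwd g) • (f ⊚ g) = idm (X ∘ Y).
Proof. by rewrite -hcomp_comp !fwdK hcomp_id. Qed.

Fact iso_hcompVK : (f ⊚ g) • (bwd f ⊚ bwd g) = idm (X' ∘ Y').
Proof. by rewrite -hcomp_comp !bwdK hcomp_id. Qed.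

Definition iso_hcomp : iso (X ∘ Y) (X' ∘ Y') := Iso iso_hcompK iso_hcompVK.

End IsoHcomp.

Definition iso_id (k : fieldType) (C : lincat k) (X : C) : iso X X :=
  iso_eq (erefl X).

Section Duals.
Variables (k : fieldType) (B : twocat k).

(** Here and below, the records named [_data] carry the data of a structure and
    a predicate [is_...] carries its axioms, so that constructions such as
    [dual_comp], [pf_comp] or [Fhat_alg] are given by formulas alone. *)
Record dual_data (a b : B) (X : cells a b) := DualData {
  ld : cells b a;
  ev : hom (X ∘ ld) (id1 b);
  coev : hom (id1 a) (ld ∘ X)
}.

Definition is_left_dual (a b : B) (X : cells a b) (D : dual_data X) : Prop :=
  (ev D ⊚ idm X) ⊙ (idm X ⊚ coev D) ≡ idm X /\
  (idm (ld D) ⊚ ev D) ⊙ (coev D ⊚ idm (ld D)) ≡ idm (ld D).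

Definition is_right_dual (a b : B) (X : cells a b) (R : cells b a)
    (evr : hom (R ∘ X) (id1 a)) (coevr : hom (id1 b) (X ∘ R)) : Prop :=
  (idm X ⊚ evr) ⊙ (coevr ⊚ idm X) ≡ idm X /\
  (evr ⊚ idm R) ⊙ (idm R ⊚ coevr) ≡ idm R.

Definition rigid : Prop :=
  forall (a b : B) (X : cells a b),
    (exists D : dual_data X, is_left_dual D) /\
    (exists (R : cells b a) (evr : hom (R ∘ X) (id1 a))
        (coevr : hom (id1 b) (X ∘ R)), is_right_dual evr coevr).

Definition finite_2cat : Prop :=
  [/\ rigid,
      forall a b : B, finite_cat (cells a b) &
      forall a : B, simple_obj (id1 a)].

Definition dual_comp (a b c : B) (Y : cells b c) (X : cells a b)
    (DY : dual_data Y) (DX : dual_data X) : dual_data (Y ∘ X) :=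
  @DualData a c (Y ∘ X) (ld DX ∘ ld DY)
    (ev DY ⊙ (idm Y ⊚ ev DX ⊚ idm (ld DY)) ⊙ idm (Y ∘ X ∘ (ld DX ∘ ld DY)))
    (idm (ld DX ∘ ld DY ∘ (Y ∘ X)) ⊙ (idm (ld DX) ⊚ coev DY ⊚ idm X) ⊙ coev DX).

(** The mate [*f : *Y -> *X] of [f : X -> Y]. *)
Definition mate (a b : B) (X Y : cells a b) (DX : dual_data X)
    (DY : dual_data Y) (f : hom X Y) : hom (ld DY) (ld DX) :=
  idm (ld DX) ⊙ (idm (ld DX) ⊚ ev DY) ⊙ (idm (ld DX) ⊚ f ⊚ idm (ld DY))
    ⊙ (coev DX ⊚ idm (ld DY)) ⊙ idm (ld DY).

End Duals.

Record pf_data (k : fieldType) (B B' : twocat k) := PfData {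
  pf0 :> B -> B';
  pf1 : forall a b : B, linfunctor (cells a b) (cells (pf0 a) (pf0 b));
  alpha : forall (a b c : B) (X : cells b c) (Y : cells a b),
    iso (pf1 b c X ∘ pf1 a b Y) (pf1 a c (X ∘ Y));
  phi : forall a : B, iso (id1 (pf0 a)) (pf1 a a (id1 a))
}.

Arguments pf1 {k B B'} p {a b}.
Arguments alpha {k B B'} p {a b c} X Y.
Arguments phi {k B B'} p a.

Section Pseudofunctors.
Variables (k : fieldType) (B B' : twocat k).

Definition is_pseudofunctor (F : pf_data B B') : Prop :=
  [/\ forall (a b c : B) (X X' : cells b c) (Y Y' : cells a b)
        (f : hom X X') (g : hom Y Y'),
        alpha F X' Y' • (fmap (pf1 F) f ⊚ fmap (pf1 F) g)
        = fmap (pf1 F) (f ⊚ g) • alpha F X Y,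
      forall (a b c d : B) (X : cells c d) (Y : cells b c) (Z : cells a b),
        alpha F X (Y ∘ Z) • (idm (pf1 F X) ⊚ alpha F Y Z)
        ≡ alpha F (X ∘ Y) Z • (alpha F X Y ⊚ idm (pf1 F Z)),
      forall (a b : B) (X : cells a b),
        alpha F (id1 b) X • (phi F b ⊚ idm (pf1 F X)) ≡ idm (pf1 F X) &
      forall (a b : B) (X : cells a b),
        alpha F X (id1 a) • (idm (pf1 F X) ⊚ phi F a) ≡ idm (pf1 F X)].

Definition is_2functor (F : pf_data B B') : Prop :=
  [/\ is_pseudofunctor F,
      forall (a b c : B) (X : cells b c) (Y : cells a b),
        exists e : pf1 F X ∘ pf1 F Y = pf1 F (X ∘ Y),
          fwd (alpha F X Y) = eqhom e &
      forall a : B,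
        exists e : id1 (F a) = pf1 F (id1 a), fwd (phi F a) = eqhom e].

Record pn_data (F G : pf_data B B') := PnData {
  pn0 :> forall a : B, cells (F a) (G a);
  pn1 : forall (a b : B) (X : cells a b),
    iso (pf1 G X ∘ pn0 a) (pn0 b ∘ pf1 F X)
}.

Arguments pn1 {F G} p {a b} X.

Definition is_pseudonatural (F G : pf_data B B') (x : pn_data F G) : Prop :=
  [/\ forall (a b : B) (X X' : cells a b) (f : hom X X'),
        (idm (x b) ⊚ fmap (pf1 F) f) • pn1 x X
        = pn1 x X' • (fmap (pf1 G) f ⊚ idm (x a)),
      forall (a b c : B) (X : cells b c) (Y : cells a b),
        (idm (x c) ⊚ alpha F X Y) ⊙ (pn1 x X ⊚ idm (pf1 F Y))
          ⊙ (idm (pf1 G X) ⊚ pn1 x Y)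
        ≡ pn1 x (X ∘ Y) • (alpha G X Y ⊚ idm (x a)) &
      forall a : B,
        pn1 x (id1 a) • (phi G a ⊚ idm (x a)) ≡ idm (x a) ⊚ phi F a].

Definition is_modification (F G : pf_data B B') (x y : pn_data F G)
    (w : forall a : B, hom (x a) (y a)) : Prop :=
  forall (a b : B) (X : cells a b),
    (w b ⊚ idm (pf1 F X)) • pn1 x X = pn1 y X • (idm (pf1 G X) ⊚ w a).

Definition pn_iso (F G : pf_data B B') (x y : pn_data F G) : Prop :=
  exists w : forall a : B, iso (x a) (y a), is_modification w.

Definition pn_id (F : pf_data B B') : pn_data F F :=
  @PnData F F (fun a => id1 (F a)) (fun a b X =>
    iso_eq (ltac:(strict) : pf1 F X ∘ id1 (F a) = id1 (F b) ∘ pf1 F X)).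

Definition pn_comp (F G H : pf_data B B') (y : pn_data G H) (x : pn_data F G) :
    pn_data F H :=
  @PnData F H (fun a => y a ∘ x a) (fun a b X =>
    iso_comps (iso_id (y b ∘ x b ∘ pf1 F X))
      (iso_comps (iso_hcomp (iso_id (y b)) (pn1 x X))
        (iso_comps (iso_hcomp (pn1 y X) (iso_id (x a)))
          (iso_id (pf1 H X ∘ (y a ∘ x a)))
          ltac:(strict)) ltac:(strict)) ltac:(strict)).

End Pseudofunctors.

Arguments pn1 {k B B' F G} p {a b} X.

Definition pf_id (k : fieldType) (B : twocat k) : pf_data B B :=
  @PfData k B B id (fun a b => linfunctor_id (cells a b))
    (fun a b c X Y => iso_id (X ∘ Y)) (fun a => iso_id (id1 a)).

Definition pf_comp (k : fieldType) (B B' B'' : twocat k)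
    (G : pf_data B' B'') (F : pf_data B B') : pf_data B B'' :=
  @PfData k B B'' (fun a => G (F a))
    (fun a b => linfunctor_comp (pf1 G) (pf1 F))
    (fun a b c X Y =>
      iso_comp (fmap_iso (pf1 G) (alpha F X Y)) (alpha G (pf1 F X) (pf1 F Y)))
    (fun a => iso_comp (fmap_iso (pf1 G) (phi F a)) (phi G (F a))).

Definition pn_equivalent (k : fieldType) (B B' : twocat k)
    (F G : pf_data B B') : Prop :=
  exists (x : pn_data F G) (y : pn_data G F),
    [/\ is_pseudonatural x, is_pseudonatural y,
        pn_iso (pn_comp y x) (pn_id F) & pn_iso (pn_comp x y) (pn_id G)].

(** A quasi-inverse of [F], together with the choices on which the functor
    between the centers depends.  [F] is a biequivalence iff it has one. *)
Record quasi_inverse (k : fieldType) (B B' : twocat k) (F : pf_data B B') :=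
    QuasiInverse {
  qi :> pf_data B' B;
  qi_pf : is_pseudofunctor qi;
  qi_left : pn_equivalent (pf_comp qi F) (pf_id B);
  qi_chi : pn_data (pf_comp F qi) (pf_id B');
  qi_tau : pn_data (pf_id B') (pf_comp F qi);
  qi_chiP : is_pseudonatural qi_chi;
  qi_tauP : is_pseudonatural qi_tau;
  qi_omega : forall c : B',
    iso (pn_comp qi_tau qi_chi c) (pn_id (pf_comp F qi) c);
  qi_omegaP : is_modification qi_omega;
  qi_epsilon : forall c : B', iso (pn_comp qi_chi qi_tau c) (pn_id (pf_id B') c);
  qi_epsilonP : is_modification qi_epsilon
}.

Section Center.
Variables (k : fieldType) (B : twocat k).

Record hb_data := HbData {
  hb0 :> forall a : B, cells a a;
  hb1 : forall (a b : B) (X : cells a b), hom (hb0 b ∘ X) (X ∘ hb0 a)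
}.

Arguments hb1 h {a b} X.

Definition is_center_object (V : hb_data) : Prop :=
  [/\ forall (a b : B) (X : cells a b), is_iso (hb1 V X),
      forall (a b : B) (X X' : cells a b) (f : hom X X'),
        (f ⊚ idm (V a)) • hb1 V X = hb1 V X' • (idm (V b) ⊚ f),
      forall a : B, hb1 V (id1 a) ≡ idm (V a) &
      forall (a b c : B) (X : cells b c) (Y : cells a b),
        hb1 V (X ∘ Y) ≡ (idm X ⊚ hb1 V Y) ⊙ (hb1 V X ⊚ idm Y)].

Definition is_center_hom (V W : hb_data) (f : forall a : B, hom (V a) (W a)) :
    Prop :=
  forall (a b : B) (X : cells a b),
    (idm X ⊚ f a) • hb1 V X = hb1 W X • (f b ⊚ idm X).

Definition center_tensor (V W : hb_data) : hb_data :=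
  @HbData (fun a => V a ∘ W a) (fun a b X =>
    idm (X ∘ (V a ∘ W a)) ⊙ (hb1 V X ⊚ idm (W a)) ⊙ (idm (V b) ⊚ hb1 W X)
      ⊙ idm (V b ∘ W b ∘ X)).

Definition center_unit : hb_data :=
  @HbData (fun a => id1 a) (fun a b X =>
    eqhom (ltac:(strict) : id1 b ∘ X = X ∘ id1 a)).

Record calg_data := CalgData {
  calg_hb :> hb_data;
  calg_mul : forall a : B, hom (calg_hb a ∘ calg_hb a) (calg_hb a);
  calg_unit : forall a : B, hom (id1 a) (calg_hb a)
}.

Definition is_center_algebra (S : calg_data) : Prop :=
  [/\ is_center_object S,
      is_center_hom (V := center_tensor S S) (W := S) (calg_mul S),
      is_center_hom (V := center_unit) (W := S) (calg_unit S),
      forall a : B,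
        calg_mul S a • (idm (S a) ⊚ calg_mul S a)
        ≡ calg_mul S a • (calg_mul S a ⊚ idm (S a)) &
      forall a : B,
        calg_mul S a • (calg_unit S a ⊚ idm (S a)) ≡ idm (S a) /\
        calg_mul S a • (idm (S a) ⊚ calg_unit S a) ≡ idm (S a)].

Definition is_calg_hom (S T : calg_data) (f : forall a : B, hom (S a) (T a)) :
    Prop :=
  [/\ is_center_hom f,
      forall a : B, f a • calg_mul S a = calg_mul T a • (f a ⊚ f a) &
      forall a : B, f a • calg_unit S a = calg_unit T a].

Definition isomorphic_center_algebras (S T : calg_data) : Prop :=
  [/\ is_center_algebra S, is_center_algebra T &
      exists (f : forall a : B, hom (S a) (T a))
          (g : forall a : B, hom (T a) (S a)),
        [/\ is_calg_hom f, is_calg_hom g,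
            forall a : B, g a • f a = idm (S a) &
            forall a : B, f a • g a = idm (T a)]].

Definition dinatural (D : forall (a b : B) (X : cells a b), dual_data X)
    (a b : B) (L : cells a a)
    (p : forall X : cells a b, hom L (ld (D a b X) ∘ X)) : Prop :=
  forall (X Y : cells a b) (f : hom X Y),
    (idm (ld (D a b X)) ⊚ f) • p X
    = (mate (D a b X) (D a b Y) f ⊚ idm Y) • p Y.

(** [L] with [p] is the end of X |-> *X ∘ X over X in B(a, b). *)
Definition is_end (D : forall (a b : B) (X : cells a b), dual_data X)
    (a b : B) (L : cells a a)
    (p : forall X : cells a b, hom L (ld (D a b X) ∘ X)) : Prop :=
  dinatural p /\
  forall (Z : cells a a) (q : forall X : cells a b, hom Z (ld (D a b X) ∘ X)),
    dinatural q -> exists! h : hom Z L, forall X, p X • h = q X.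

(** As an end is only determined up to isomorphism, so is the adjoint algebra.
    The [mate] below is the canonical isomorphism *(Y ∘ X) -> *X ∘ *Y. *)
Definition is_adjoint_algebra
    (D : forall (a b : B) (X : cells a b), dual_data X) (b : B)
    (S : calg_data) : Prop :=
  is_center_algebra S /\
  exists p : forall (a : B) (X : cells a b), hom (S a) (ld (D a b X) ∘ X),
    [/\ forall a : B, is_end (p a),
        forall (a c : B) (X : cells c a) (Y : cells a b),
          p a Y ⊚ idm X
          ≡ (ev (D c a X) ⊚ idm (ld (D a b Y) ∘ Y ∘ X))
            ⊙ (idm X ⊚ (mate (dual_comp (D a b Y) (D c a X)) (D c b (Y ∘ X))
                          (idm (Y ∘ X)) ⊚ idm (Y ∘ X)))
            ⊙ (idm X ⊚ p c (Y ∘ X)) ⊙ hb1 S X,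
        forall (a : B) (X : cells a b),
          p a X • calg_mul S a
          ≡ (idm (ld (D a b X)) ⊚ ev (D a b X) ⊚ idm X) ⊙ (p a X ⊚ p a X) &
        forall (a : B) (X : cells a b),
          p a X • calg_unit S a = coev (D a b X)].

End Center.

Arguments hb1 {k B} h {a b} X.

Section Fhat.
Variables (k : fieldType) (B B' : twocat k) (F : pf_data B B').
Variable G : quasi_inverse F.

Local Notation chi := (qi_chi G).
Local Notation tau := (qi_tau G).
Local Notation omega := (qi_omega G).
Local Notation epsilon := (qi_epsilon G).

Definition Fhat (V : hb_data B) : hb_data B' :=
  @HbData k B' (fun c => chi c ∘ pf1 F (V (G c)) ∘ tau c) (fun c d Y =>
    idm (Y ∘ (chi c ∘ pf1 F (V (G c)) ∘ tau c))
    ⊙ (bwd (pn1 chi Y) ⊚ idm (pf1 F (V (G c)) ∘ tau c))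
    ⊙ (idm (chi d)
        ⊚ (bwd (alpha F (pf1 G Y) (V (G c)))
           • fmap (pf1 F) (hb1 V (pf1 G Y))
           • alpha F (V (G d)) (pf1 G Y))
        ⊚ idm (tau c))
    ⊙ (idm (chi d ∘ pf1 F (V (G d))) ⊚ bwd (pn1 tau Y))
    ⊙ idm (chi d ∘ pf1 F (V (G d)) ∘ tau d ∘ Y)).

Definition Fhat_hom (V W : hb_data B) (f : forall a : B, hom (V a) (W a))
    (c : B') : hom (Fhat V c) (Fhat W c) :=
  idm (chi c) ⊚ fmap (pf1 F) (f (G c)) ⊚ idm (tau c).

Definition Fhat_tensor (V W : hb_data B) (c : B') :
    hom (center_tensor (Fhat V) (Fhat W) c) (Fhat (center_tensor V W) c) :=
  (idm (chi c) ⊚ alpha F (V (G c)) (W (G c)) ⊚ idm (tau c))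
  ⊙ (idm (chi c ∘ pf1 F (V (G c))) ⊚ omega c ⊚ idm (pf1 F (W (G c)) ∘ tau c))
  ⊙ idm (Fhat V c ∘ Fhat W c).

(** The 2-cell I -> chi ∘ tau that is the unit of an adjunction with counit
    omega: it is the only one with (id_chi ⊚ omega) ⊙ (eta ⊚ id_chi) = id_chi,
    and does not depend on the choice of epsilon. *)
Definition eta (c : B') : hom (id1 c) (chi c ∘ tau c) :=
  idm (chi c ∘ tau c)
  ⊙ (epsilon c ⊚ idm (chi c ∘ tau c))
  ⊙ (idm (chi c) ⊚ bwd (omega c) ⊚ idm (tau c))
  ⊙ bwd (epsilon c).

(** The unit constraint of the monoidal functor is determined by
    [Fhat_tensor]. *)
Definition Fhat_unit (c : B') :
    hom (center_unit B' c) (Fhat (center_unit B) c) :=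
  (idm (chi c) ⊚ phi F (G c) ⊚ idm (tau c)) ⊙ eta c.

Definition Fhat_alg (S : calg_data B) : calg_data B' :=
  @CalgData k B' (Fhat S)
    (fun c => Fhat_hom (V := center_tensor S S) (W := S) (calg_mul S) c
                • Fhat_tensor S S c)
    (fun c => Fhat_hom (V := center_unit B) (W := S) (calg_unit S) c
                • Fhat_unit c).

End Fhat.

(* Main.v *)
From mathcomp Require Import all_boot all_algebra.
From mathcomp Require Import boolp.
Require Import Defs.

(** Transposing the dinatural family [L -> *Y ∘ Y] along the duality turns it
    into a natural family of actions [Y ∘ L -> Y], so the adjoint algebra of [b]
    is the universal family of 1-cells [S a] acting naturally on the right of
    all 1-cells [Y : a -> b]; its half-braiding, multiplication and unit are
    characterized by compatibility with the action, with no duals left.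
    A universal action is carried along [F], which is locally an equivalence of
    categories, to a universal action of [F (S (G c))] on the 1-cells
    [F (G c) -> F b], and then along the adjoint equivalence between
    [c] and [F (G c)], to one of [chi c ∘ F (S (G c)) ∘ tau c] on the
    1-cells [c -> F b]. Hence [Fhat (Ad_b)] and [Ad_(F b)] have the same
    universal property, and the comparison isomorphism respects the structure.
    That [Fhat (Ad_b)] is an algebra in the center is transported
    from [Ad_(F b)] along this isomorphism. *)

Set Implicit Arguments.
Unset Strict Implicit.
Unset Printing Implicit Defensive.

(** * Untyped 2-cells *)

Section Cells.
Variables (k : fieldType) (B : twocat k).

(** A 2-cell packed with its boundary; [None] is the result of composing
    vertically two cells that do not match. Packing turns [≡] into Leibniz
    equality, so horizontal composition [⊠] is associative and unital by
    rewriting, and no associator has to be inserted in pasting diagrams. *)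
Definition cell2 (a b : B) : Type :=
  option {X : cells a b & {Y : cells a b & hom X Y}}.

Definition cl (a b : B) (X Y : cells a b) (f : hom X Y) : cell2 a b :=
  Some (existT _ X (existT _ Y f)).

Definition vc (a b : B) (p q : cell2 a b) : cell2 a b :=
  match p, q with
  | Some (existT Y' (existT Z g)), Some (existT X (existT Y f)) =>
      match pselect (Y = Y') with
      | left e => cl (comps g f e)
      | right _ => None
      end
  | _, _ => None
  end.

Definition hc (a b c : B) (p : cell2 b c) (q : cell2 a b) : cell2 a c :=
  match p, q with
  | Some (existT X (existT X' f)), Some (existT Y (existT Y' g)) =>
      cl (f ⊚ g)
  | _, _ => None
  end.

End Cells.

Arguments cl : simpl never.
Arguments vc : simpl never.
Arguments hc : simpl never.

Notation "p * q" := (vc p q) : cell_scope.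
Notation "p ⊠ q" := (hc p q) (at level 35, right associativity) : cell_scope.
Notation "'1_ X" := (cl (idm X))
  (at level 8, X at level 2, format "''1_' X") : cell_scope.
Delimit Scope cell_scope with cell.
Local Open Scope cell_scope.

Section CellTheory.
Variables (k : fieldType) (B : twocat k).

(** Equality of 1-cells is a proposition, so proof irrelevance reduces the transports in an equality
    of dependent pairs to [erefl]. *)
Lemma cl_inj (a b : B) (X Y : cells a b) (f g : hom X Y) :
  cl f = cl g -> f = g.
Proof.
case=> E; have := projT2_eq E.
rewrite (Prop_irrelevance (projT1_eq E) erefl) /= => {}E; have := projT2_eq E.
by rewrite (Prop_irrelevance (projT1_eq E) erefl).
Qed.

Lemma cl_eqs (a b : B) (X X' Y Y' : cells a b) (f : hom X Y) (g : hom X' Y')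
  (e : X = X') (e' : Y = Y') : eqs f g e e' <-> cl f = cl g.
Proof.
case: X' / e g => g; case: Y' / e' g => g.
by rewrite /eqs /= comp1m compm1; split=> [->|/cl_inj].
Qed.

Lemma cl_comps (a b : B) (X Y Y' Z : cells a b) (g : hom Y' Z) (f : hom X Y)
    (e : Y = Y') :
  cl (comps g f e) = cl g * cl f.
Proof.
rewrite /vc /=; case: pselect => [e'|]; last by [].
by rewrite (Prop_irrelevance e e').
Qed.

Lemma cl_comp (a b : B) (X Y Z : cells a b) (g : hom Y Z) (f : hom X Y) :
  cl (g • f) = cl g * cl f.
Proof. by rewrite -(cl_comps g f erefl) /comps /= comp1m. Qed.

Lemma cl_eqhom (a b : B) (X Y : cells a b) (e : X = Y) : cl (eqhom e) = '1_X.
Proof. by case: Y / e. Qed.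

Lemma cl_hcomp (a b c : B) (X X' : cells b c) (Y Y' : cells a b)
  (f : hom X X') (g : hom Y Y') : cl (f ⊚ g) = cl f ⊠ cl g.
Proof. by []. Qed.

Lemma cl_id2 (a b c : B) (X : cells b c) (Y : cells a b) :
  '1_(X ∘ Y) = '1_X ⊠ '1_Y.
Proof. by rewrite -cl_hcomp hcomp_id. Qed.

Lemma vc_None (a b : B) (X X' Y Y' : cells a b) (g : hom Y' X') (f : hom X Y) :
  Y <> Y' -> cl g * cl f = None.
Proof. by rewrite /vc /=; case: pselect. Qed.

Lemma vcA (a b : B) (p q r : cell2 a b) : (p * q) * r = p * (q * r).
Proof.
case: p q r => [[Z [W h]]|] [[Y [Z' g]]|] [[X [Y' f]]|] //; last first.
- by rewrite /vc; case: pselect.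
rewrite -/(cl h) -/(cl g) -/(cl f).
case: (pselect (Z' = Z)) => [e|n].
  case: Z / e h => h; rewrite -cl_comp.
  case: (pselect (Y' = Y)) => [e|n].
    by case: Y / e g => g; rewrite -!cl_comp compA.
  by rewrite !vc_None.
rewrite vc_None //; case: (pselect (Y' = Y)) => [e|n'].
  by case: Y / e g => g; rewrite -cl_comp vc_None.
by rewrite (vc_None _ _ n').
Qed.

Lemma vc1l (a b : B) (X Y : cells a b) (f : hom X Y) : '1_Y * cl f = cl f.
Proof. by rewrite -cl_comp comp1m. Qed.

Lemma vc1r (a b : B) (X Y : cells a b) (f : hom X Y) : cl f * '1_X = cl f.
Proof. by rewrite -cl_comp compm1. Qed.

Lemma hcA (a b c d : B) (p : cell2 c d) (q : cell2 b c) (r : cell2 a b) :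
  (p ⊠ q) ⊠ r = p ⊠ (q ⊠ r).
Proof.
case: p q r => [[Z [Z' h]]|] [[Y [Y' g]]|] [[X [X' f]]|] //.
by symmetry; apply: (iffLR (cl_eqs _ _ _ _) (hcompA h g f)).
Qed.

Lemma hc1l (a b : B) (p : cell2 a b) : '1_(id1 b) ⊠ p = p.
Proof.
case: p => [[X [X' f]]|] //.
exact: (iffLR (cl_eqs _ _ _ _) (hcomp1f f)).
Qed.

Lemma hc1r (a b : B) (p : cell2 a b) : p ⊠ '1_(id1 a) = p.
Proof.
case: p => [[X [X' f]]|] //.
exact: (iffLR (cl_eqs _ _ _ _) (hcompf1 f)).
Qed.

(** The type of a packed cell forgets its boundary; this predicate recovers it, to justify
    distributing, dropping identities and cancelling. *)
Definition typed (a b : B) (p : cell2 a b) (X Y : cells a b) : Prop :=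
  exists f : hom X Y, p = cl f.

Lemma typed_cl (a b : B) (X Y : cells a b) (f : hom X Y) : typed (cl f) X Y.
Proof. by exists f. Qed.

Lemma typed_vc (a b : B) (p q : cell2 a b) (X Y Y' Z : cells a b) :
  typed q X Y -> typed p Y' Z -> Y = Y' -> typed (p * q) X Z.
Proof. by move=> [f ->] [g ->] e; exists (comps g f e); rewrite cl_comps. Qed.

Lemma typed_hc (a b c : B) (p : cell2 b c) (q : cell2 a b) X X' Y Y' :
  typed p X X' -> typed q Y Y' -> typed (p ⊠ q) (X ∘ Y) (X' ∘ Y').
Proof. by move=> [f ->] [g ->]; exists (f ⊚ g). Qed.

(** The side conditions exclude mismatched cells: distinct 1-cells can have equal horizontal
    composites, so the right-hand side may be defined when [p * q] is not. *)
Lemma hc_vc (a b c : B) (p q : cell2 b c) (r s : cell2 a b) :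
  p * q <> None -> r * s <> None ->
  (p * q) ⊠ (r * s) = (p ⊠ r) * (q ⊠ s).
Proof.
case: p q r s => [[Y [Z g]]|] [[X [Y1 f]]|] // [[V [W i]]|] [[U [V1 h]]|] //.
rewrite -/(cl f) -/(cl g) -/(cl h) -/(cl i).
case: (pselect (Y1 = Y)) => [e _|n]; last by rewrite vc_None.
case: (pselect (V1 = V)) => [e' _|n]; last by rewrite (vc_None _ _ n).
case: Y / e g => g; case: V / e' i => i.
by rewrite -!cl_hcomp -!cl_comp -!cl_hcomp hcomp_comp.
Qed.

Lemma typed_defined (a b : B) (p : cell2 a b) X Y : typed p X Y -> p <> None.
Proof. by move=> [f ->]. Qed.

Lemma hc_id_vc (a b c : B) (U : cells b c) (p q : cell2 a b) :
  p * q <> None -> '1_U ⊠ (p * q) = ('1_U ⊠ p) * ('1_U ⊠ q).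
Proof. by move=> h; rewrite -{1}(vc1l (idm U)) hc_vc // vc1l. Qed.

Lemma hc_vc_id (a b c : B) (U : cells a b) (p q : cell2 b c) :
  p * q <> None -> (p * q) ⊠ '1_U = (p ⊠ '1_U) * (q ⊠ '1_U).
Proof. by move=> h; rewrite -{1}(vc1l (idm U)) hc_vc // vc1l. Qed.

Lemma interchange (a b c : B) (X X' : cells b c) (Y Y' : cells a b)
  (f : hom X X') (g : hom Y Y') :
  (cl f ⊠ '1_Y') * ('1_X ⊠ cl g) = ('1_X' ⊠ cl g) * (cl f ⊠ '1_Y).
Proof. by rewrite -!cl_hcomp -!cl_comp -!hcomp_comp !(comp1m, compm1). Qed.

Lemma hc_split (a b c : B) (X X' : cells b c) (Y Y' : cells a b)
  (f : hom X X') (g : hom Y Y') :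
  cl f ⊠ cl g = (cl f ⊠ '1_Y') * ('1_X ⊠ cl g).
Proof. by rewrite -!cl_hcomp -!cl_comp -!hcomp_comp !(comp1m, compm1). Qed.

(** In a right-associated composite, a block of consecutive layers is a subterm only if it comes
    last; the tail [z] allows rewriting it elsewhere. *)
Lemma vc_rewrite2 (a b : B) (p q r : cell2 a b) :
  p * q = r -> forall z, p * (q * z) = r * z.
Proof. by move=> <- z; rewrite vcA. Qed.

Lemma vc_rewrite3 (a b : B) (p q r s : cell2 a b) :
  p * (q * r) = s -> forall z, p * (q * (r * z)) = s * z.
Proof. by move=> <- z; rewrite !vcA. Qed.

Lemma vc_rewrite4 (a b : B) (p q r t s : cell2 a b) :
  p * (q * (r * t)) = s -> forall z, p * (q * (r * (t * z))) = s * z.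
Proof. by move=> <- z; rewrite !vcA. Qed.

Lemma vc_rewrite5 (a b : B) (p q r t u s : cell2 a b) :
  p * (q * (r * (t * u))) = s -> forall z, p * (q * (r * (t * (u * z)))) = s * z.
Proof. by move=> <- z; rewrite !vcA. Qed.

Lemma whisker (a b c d : B) (p q : cell2 b c) (U : cells c d) (V : cells a b) :
  p = q -> '1_U ⊠ (p ⊠ '1_V) = '1_U ⊠ (q ⊠ '1_V).
Proof. by move=> ->. Qed.

Lemma whiskerl (a b c : B) (p q : cell2 a b) (U : cells b c) :
  p = q -> '1_U ⊠ p = '1_U ⊠ q.
Proof. by move=> ->. Qed.

Lemma whiskerr (a b c : B) (p q : cell2 b c) (V : cells a b) :
  p = q -> p ⊠ '1_V = q ⊠ '1_V.
Proof. by move=> ->. Qed.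

Lemma iso_vcK (a b : B) (X Y : cells a b) (f : iso X Y) : cl (bwd f) * cl f = '1_X.
Proof. by rewrite -cl_comp fwdK. Qed.

Lemma iso_vcVK (a b : B) (X Y : cells a b) (f : iso X Y) : cl f * cl (bwd f) = '1_Y.
Proof. by rewrite -cl_comp bwdK. Qed.

Lemma vc_idl (a b : B) (q p : cell2 a b) X Y Y' :
  q = '1_Y' -> typed p X Y -> Y = Y' -> q * p = p.
Proof. by move=> -> [f ->] <-; apply: vc1l. Qed.

Lemma vc_idr (a b : B) (q p : cell2 a b) X X' Y :
  q = '1_X' -> typed p X Y -> X = X' -> p * q = p.
Proof. by move=> -> [f ->] <-; apply: vc1r. Qed.

Lemma iso_vc_inj (a b : B) (X Y : cells a b) (f : iso X Y) (p q : cell2 a b)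
    U V X' X'' :
  cl f * p = cl f * q -> typed p U X' -> typed q V X'' ->
  X' = X -> X'' = X -> p = q.
Proof.
move=> e [p' ep] [q' eq] eX eX'; subst X' X''.
rewrite -(vc_idl (q := cl (bwd f) * cl f) (iso_vcK f) (ex_intro _ p' ep) erefl).
by rewrite vcA e -vcA (vc_idl (iso_vcK f) (ex_intro _ q' eq) erefl).
Qed.

End CellTheory.

(** * Tactics for normalizing pasting diagrams *)

Ltac solve_strict := by rewrite /= ?(comp1A, comp11X, comp1X1).
Ltac infer_type :=
  lazymatch goal with
  | |- typed (vc _ _) _ _ => eapply typed_vc; [infer_type | infer_type | solve_strict]
  | |- typed (hc _ _) _ _ => eapply typed_hc; [infer_type | infer_type]
  | |- typed (cl _) _ _ => eapply typed_cl
  end.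
Ltac defined := eapply typed_defined; infer_type.

Ltac push_cl := rewrite ?(cl_comps, cl_comp, cl_hcomp, cl_eqhom).
Ltac distribute :=
  repeat match goal with
  | |- context [hc (cl (idm ?U)) (vc ?p ?q)] =>
      rewrite (@hc_id_vc _ _ _ _ _ U p q ltac:(defined))
  | |- context [hc (vc ?p ?q) (cl (idm ?U))] =>
      rewrite (@hc_vc_id _ _ _ _ _ U p q ltac:(defined))
  end.
Ltac all_id q :=
  lazymatch q with
  | cl (idm _) => idtac
  | hc ?q1 ?q2 => all_id q1; all_id q2
  end.
Ltac fold_ids := rewrite -?cl_id2; reflexivity.
Ltac drop_ids :=
  repeat match goal with
  | |- context [vc ?q ?p] => all_id q;
      rewrite (@vc_idl _ _ _ _ q p _ _ _ ltac:(fold_ids) ltac:(infer_type)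
                 ltac:(solve_strict))
  | |- context [vc ?p ?q] => all_id q;
      rewrite (@vc_idr _ _ _ _ q p _ _ _ ltac:(fold_ids) ltac:(infer_type)
                 ltac:(solve_strict))
  end.
Ltac flatten_cells := rewrite ?(cl_id2, hcA, vcA, hc1l, hc1r).

(** The normal form is a right-associated vertical composite of layers, each
    layer being a right-associated [⊠] of generating cells and identities of
    generating 1-cells; [nf_rewrite] rewrites with an equation between 2-cells
    after normalizing it, anywhere in such a composite. *)
Ltac nf := push_cl; distribute; flatten_cells; drop_ids.
Ltac rewrite_vc H :=
  first [ rewrite H | rewrite (vc_rewrite5 H) | rewrite (vc_rewrite4 H)
        | rewrite (vc_rewrite3 H) | rewrite (vc_rewrite2 H) ];
  rewrite ?vcA.
Tactic Notation "nf_rewrite" uconstr(t) :=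
  let E := fresh "E" in (have := t); nf => E; rewrite_vc E; drop_ids; clear E.
Ltac cancel_iso f :=
  eapply (iso_vc_inj (f := f));
    [| infer_type | infer_type | solve_strict | solve_strict].

(** * Adjoint algebras as universal actions *)

Section Duality.
Variables (k : fieldType) (B : twocat k).

Lemma left_dualE (a b : B) (X : cells a b) (D : dual_data X) :
  is_left_dual D ->
  (cl (ev D) ⊠ '1_X) * ('1_X ⊠ cl (coev D)) = '1_X /\
  ('1_(ld D) ⊠ cl (ev D)) * (cl (coev D) ⊠ '1_(ld D)) = '1_(ld D).
Proof. by case=> /cl_eqs + /cl_eqs; nf. Qed.

(** Sliding [ev DY] and [f] past [ev DX] leaves a zigzag of [X]. The hypothesis is the triangle that
    [dual_comp_triangle] supplies for composite duals. *)
Lemma mate_ev (a b : B) (X Y : cells a b) (DX : dual_data X) (DY : dual_data Y)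
    (f : hom X Y) :
  (cl (ev DX) ⊠ '1_X) * ('1_X ⊠ cl (coev DX)) = '1_X ->
  cl (ev DX) * ('1_X ⊠ cl (mate DX DY f)) = cl (ev DY) * (cl f ⊠ '1_(ld DY)).
Proof.
move=> tX; rewrite /mate; nf.
nf_rewrite (interchange (ev DX) (ev DY)).
nf_rewrite (interchange (ev DX) (f ⊚ idm (ld DY))).
by nf_rewrite (whiskerr (ld DY) tX).
Qed.

(** Interchange moves [ev DX] past [coev DY]; the zigzags of [Y] and of [X] then straighten in
    turn. *)
Lemma dual_comp_triangle (a b c : B) (Y : cells b c) (X : cells a b)
    (DY : dual_data Y) (DX : dual_data X) :
  is_left_dual DY -> is_left_dual DX ->
  let D := dual_comp DY DX in
  (cl (ev D) ⊠ '1_(Y ∘ X)) * ('1_(Y ∘ X) ⊠ cl (coev D)) = '1_(Y ∘ X).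
Proof.
move=> /left_dualE [tY _] /left_dualE [tX _] /=; nf.
nf_rewrite (whiskerl Y (interchange (ev DX) (coev DY ⊚ idm X))).
nf_rewrite (whiskerr X tY).
by nf_rewrite (whiskerl Y tX).
Qed.

Definition natural_action (a b : B) (Z : cells a a)
    (t : forall Y : cells a b, hom (Y ∘ Z) Y) : Prop :=
  forall (X Y : cells a b) (f : hom X Y), f • t X = t Y • (f ⊚ idm Z).

(** The transposed form of [is_end]: [S] represents the functor sending [Z] to the natural families
    [Y ∘ Z -> Y]. *)
Definition universal_action (a b : B) (S : cells a a)
    (act : forall Y : cells a b, hom (Y ∘ S) Y) : Prop :=
  natural_action act /\
  forall (Z : cells a a) (t : forall Y : cells a b, hom (Y ∘ Z) Y),
    natural_action t ->
    exists! h : hom Z S, forall Y, act Y • (idm Y ⊚ h) = t Y.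

(** The transposes of the defining equations of [is_adjoint_algebra] under
    [act Y = (ev_Y ∘ Y) (Y ∘ p_Y)]. *)
Definition adjoint_action (b : B) (S : calg_data B)
    (act : forall (a : B) (Y : cells a b), hom (Y ∘ S a) Y) : Prop :=
  [/\ forall a, universal_action (act a),
      forall (a c : B) (X : cells c a) (Y : cells a b),
        cl (act a Y) ⊠ '1_X = cl (act c (Y ∘ X)) * ('1_Y ⊠ cl (hb1 S X)),
      forall (a : B) (Y : cells a b),
        cl (act a Y) * ('1_Y ⊠ cl (calg_mul S a))
        = cl (act a Y) * (cl (act a Y) ⊠ '1_(S a)) &
      forall (a : B) (Y : cells a b),
        cl (act a Y) * ('1_Y ⊠ cl (calg_unit S a)) = '1_Y].

(** The bijection of the adjunction between [X ∘ -] and [ld D ∘ -], with counit [ev D]; the leading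
    [idm W] makes the target [W] itself. *)
Definition transpose (a b c : B) (X : cells a b) (D : dual_data X)
    (Z : cells c a) (W : cells c b) (h : hom Z (ld D ∘ W)) : hom (X ∘ Z) W :=
  idm W ⊙ ((ev D ⊚ idm W) ⊙ (idm X ⊚ h)).

Definition untranspose (a b c : B) (X : cells a b) (D : dual_data X)
    (Z : cells c a) (W : cells c b) (t : hom (X ∘ Z) W) : hom Z (ld D ∘ W) :=
  (idm (ld D) ⊚ t) ⊙ ((coev D ⊚ idm Z) ⊙ idm Z).

Lemma cl_transpose (a b c : B) (X : cells a b) (D : dual_data X)
    (Z : cells c a) (W : cells c b) (h : hom Z (ld D ∘ W)) :
  cl (transpose h) = (cl (ev D) ⊠ '1_W) * ('1_X ⊠ cl h).
Proof. by rewrite /transpose; nf. Qed.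

Lemma cl_untranspose (a b c : B) (X : cells a b) (D : dual_data X)
    (Z : cells c a) (W : cells c b) (t : hom (X ∘ Z) W) :
  cl (untranspose D t) = ('1_(ld D) ⊠ cl t) * (cl (coev D) ⊠ '1_Z).
Proof. by rewrite /untranspose; nf. Qed.

Lemma transposeK (a b c : B) (X : cells a b) (D : dual_data X)
    (Z : cells c a) (W : cells c b) (h : hom Z (ld D ∘ W)) :
  is_left_dual D -> untranspose D (transpose h) = h.
Proof.
move=> /left_dualE [_ t]; apply: cl_inj; rewrite cl_untranspose cl_transpose; nf.
nf_rewrite (esym (interchange (coev D) h)).
by nf_rewrite (whiskerr W t).
Qed.

Lemma untransposeK (a b c : B) (X : cells a b) (D : dual_data X)
    (Z : cells c a) (W : cells c b) (t : hom (X ∘ Z) W) :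
  is_left_dual D -> transpose (untranspose D t) = t.
Proof.
move=> /left_dualE [h _]; apply: cl_inj; rewrite cl_transpose cl_untranspose; nf.
nf_rewrite (interchange (ev D) t).
by nf_rewrite (whiskerr Z h).
Qed.

(** Transposition is injective and takes the two sides of dinaturality to those of naturality, one
    by interchange, the other by [mate_ev]. *)
Lemma dinatural_transpose (D : forall (a b : B) (X : cells a b), dual_data X)
    (D_dual : forall (a b : B) (X : cells a b), is_left_dual (D a b X))
    (a b : B) (Z : cells a a)
    (q : forall X : cells a b, hom Z (ld (D a b X) ∘ X)) :
  dinatural q <-> natural_action (fun X => transpose (q X)).
Proof.
have eqv (X Y : cells a b) (f : hom X Y) :
  (transpose ((idm (ld (D a b X)) ⊚ f) • q X) = f • transpose (q X)) /\
  (transpose ((mate (D a b X) (D a b Y) f ⊚ idm Y) • q Y)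
   = transpose (q Y) • (f ⊚ idm Z)).
  split; apply: cl_inj; rewrite !(cl_transpose, cl_comp, cl_hcomp); nf.
    by nf_rewrite (interchange (ev (D a b X)) f).
  have [tX _] := left_dualE (D_dual a b X).
  nf_rewrite (whiskerr Y (mate_ev (D a b Y) f tX)).
  by nf_rewrite (interchange f (q Y)).
split=> h X Y f; have [e1 e2] := eqv X Y f.
  by rewrite -e1 -e2 h.
have := h X Y f; rewrite -e1 -e2 => /(congr1 (fun t => untranspose (D a b X) t)).
by rewrite !transposeK.
Qed.

Lemma adjoint_algebra_action
    (D : forall (a b : B) (X : cells a b), dual_data X)
    (D_dual : forall (a b : B) (X : cells a b), is_left_dual (D a b X))
    (b : B) (S : calg_data B) :
  is_adjoint_algebra D b S ->
  exists act : forall (a : B) (Y : cells a b), hom (Y ∘ S a) Y,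
    adjoint_action act.
Proof.
case=> _ [p [endp hbp mulp unitp]].
exists (fun a Y => transpose (p a Y)); split=> [a|a c X Y|a Y|a Y].
- case: (endp a) => dp univ; split; first exact/dinatural_transpose.
  move=> Z t nt; have [|h [hP hU]] := univ Z (fun Y => untranspose (D a b Y) (t Y)).
    apply/dinatural_transpose => // X Y f.
    by rewrite !untransposeK.
  exists h; split=> [Y|h' h'P].
    rewrite -[RHS](untransposeK (t Y) (D_dual a b Y)) -hP.
    by apply: cl_inj; rewrite !(cl_transpose, cl_comp, cl_hcomp); nf.
  apply: hU => Y; rewrite -[LHS](transposeK _ (D_dual a b Y)) -h'P; congr untranspose.
  by apply: cl_inj; rewrite !(cl_transpose, cl_comp, cl_hcomp); nf.
- rewrite /= !cl_transpose; have /cl_eqs := hbp a c X Y; nf => hb.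
  nf_rewrite (whiskerl Y hb).
  (* The evaluation of the composite dual absorbs the canonical isomorphism and becomes the
     evaluation of the given dual of [Y ∘ X]. *)
  have mE := mate_ev (D c b (Y ∘ X)) (idm (Y ∘ X))
    (dual_comp_triangle (D_dual a b Y) (D_dual c a X)).
  by nf_rewrite (whiskerr (Y ∘ X) mE).
- rewrite /= !cl_transpose; have /cl_eqs := mulp a Y; nf => m.
  nf_rewrite (whiskerl Y m); rewrite (hc_split (p a Y) (p a Y)); nf.
  nf_rewrite (whiskerr Y (interchange (ev (D a b Y)) (ev (D a b Y)))).
  nf_rewrite (whiskerl Y (interchange (p a Y) (p a Y))).
  by nf_rewrite (interchange (ev (D a b Y)) (idm Y ⊚ p a Y)).
- rewrite /= cl_transpose; have m := congr1 (@cl _ _ _ _ _ _) (unitp a Y).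
  move: m; nf => m; nf_rewrite (whiskerl Y m).
  by have [-> _] := left_dualE (D_dual a b Y).
Qed.

End Duality.

(** * Uniqueness of the algebra carrying a universal action *)

Section Transport.
Variables (k : fieldType) (B : twocat k).

(** The functor [- ∘ X] has the left adjoint [- ∘ *X], hence preserves the
    limit [S]. *)
Lemma universal_action_monic (a b c : B) (S : cells a a)
    (act : forall Y : cells a b, hom (Y ∘ S) Y) (X : cells c a)
    (D : dual_data X) (Z : cells c a) (f g : hom Z (S ∘ X)) :
  universal_action act -> is_left_dual D ->
  (forall Y, (cl (act Y) ⊠ '1_X) * ('1_Y ⊠ cl f)
             = (cl (act Y) ⊠ '1_X) * ('1_Y ⊠ cl g)) -> f = g.
Proof.
case=> nat univ /left_dualE [tX _] eqfg.
(* [hat h] is the transpose of [h], from which [hatP] recovers [h]; [hat f] and [hat g] agree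
   because they classify the same action. *)
have [hat hatE] : exists hat : hom Z (S ∘ X) -> hom (Z ∘ ld D) S,
    forall h, cl (hat h) = ('1_S ⊠ cl (ev D)) * (cl h ⊠ '1_(ld D)).
  exists (fun h => idm S ⊙ ((idm S ⊚ ev D) ⊙ (h ⊚ idm (ld D)))) => h.
  by nf.
have hatP h : cl h = (cl (hat h) ⊠ '1_X) * ('1_Z ⊠ cl (coev D)).
  rewrite hatE; nf; nf_rewrite (interchange h (coev D)).
  by nf_rewrite (whiskerl S tX).
apply: cl_inj; rewrite (hatP f) (hatP g); congr (cl _ ⊠ _ * _).
pose t Y := act Y • (idm Y ⊚ hat f).
have nt : natural_action t.
  move=> Y Y' h; rewrite /t compA nat; apply: cl_inj; nf.
  by nf_rewrite (interchange h (hat f)).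
have [h [_ uh]] := univ _ t nt.
rewrite -(uh (hat f)) // -(uh (hat g)) // => Y.
apply: cl_inj; rewrite /t !(cl_comp, cl_hcomp) !hatE; nf.
nf_rewrite (interchange (act Y) (ev D)).
nf_rewrite (interchange (act Y) (ev D)).
by nf_rewrite (whiskerr (ld D) (eqfg Y)).
Qed.

(** Since [f] intertwines the data, the half-braiding of [S] is conjugate to that of [T], and the
    algebra identities become those of [T] after composition with the invertible [f]. *)
Lemma center_algebra_transport (S T : calg_data B)
    (f : forall a : B, iso (S a) (T a)) :
  is_center_algebra T -> is_calg_hom f -> is_center_algebra S.
Proof.
move=> [[isoT natT idT compT] mulT unitT assT neuT] [hbf mulf unitf].
pose g a := bwd (f a).
have fK a : cl (g a) * cl (f a) = '1_(S a) := iso_vcK (f a).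
have fVK a : cl (f a) * cl (g a) = '1_(T a) := iso_vcVK (f a).
have hbE (a b : B) (X : cells a b) :
  hb1 S X = (idm X ⊚ g a) • (hb1 T X • (f b ⊚ idm X)).
  by rewrite -hbf compA -hcomp_comp fwdK comp1m hcomp_id comp1m.
have ff a : cl (f a) ⊠ cl (f a) = (cl (f a) ⊠ '1_(T a)) * ('1_(S a) ⊠ cl (f a)).
  exact: hc_split.
have mulE a : cl (f a) * cl (calg_mul S a)
    = cl (calg_mul T a) * ((cl (f a) ⊠ '1_(T a)) * ('1_(S a) ⊠ cl (f a))).
  by rewrite -ff -cl_comp mulf; nf.
have hbfE (a b : B) (X : cells a b) : ('1_X ⊠ cl (f a)) * cl (hb1 S X)
    = cl (hb1 T X) * (cl (f b) ⊠ '1_X).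
  by rewrite -cl_hcomp -cl_comp hbf; nf.
split; first split=> [a b X|a b X X' h|a|a b c X Y].
- have [i iE] := isoT a b X.
  exists (iso_comp (iso_hcomp (iso_id X) (iso_inv (f a)))
            (iso_comp i (iso_hcomp (f b) (iso_id X)))).
  by rewrite hbE iE.
- apply: cl_inj; rewrite !hbE; nf; nf_rewrite (interchange h (g a)).
  have n := congr1 (@cl _ _ _ _ _ _) (natT a b X X' h); move: n; nf => n.
  rewrite_vc n; by nf_rewrite (interchange (f b) h).
- apply/cl_eqs; rewrite hbE; have /cl_eqs := idT a; nf => ->.
  by drop_ids; rewrite fK.
- apply/cl_eqs; rewrite !hbE; have /cl_eqs := compT a b c X Y; nf => n.
  rewrite_vc n; by nf_rewrite (whisker X Y (fVK b)).
- move=> a b X; apply: cl_inj; cancel_iso (iso_hcomp (iso_id X) (f a)); nf.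
  nf_rewrite (whiskerl X (mulE a)).
  nf_rewrite (esym (interchange (hb1 S X) (f a))).
  nf_rewrite (whiskerr (T a) (hbfE a b X)).
  nf_rewrite (whiskerl (S b) (hbfE a b X)).
  nf_rewrite (interchange (f b) (hb1 T X)).
  have n := congr1 (@cl _ _ _ _ _ _) (mulT a b X); move: n; rewrite /=; nf => n.
  rewrite_vc n; nf_rewrite (hbfE a b X).
  by nf_rewrite (whiskerr X (mulE b)).
- move=> a b X; apply: cl_inj; cancel_iso (iso_hcomp (iso_id X) (f a)); nf.
  have uE' c := congr1 (@cl _ _ _ _ _ _) (unitf c).
  have n := congr1 (@cl _ _ _ _ _ _) (unitT a b X); move: n; rewrite /=; nf => n.
  nf_rewrite (whiskerl X (uE' a)); drop_ids.
  rewrite_vc n; nf_rewrite (hbfE a b X).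
  by nf_rewrite (whiskerr X (uE' b)).
- move=> a; apply/cl_eqs; cancel_iso (f a); nf.
  nf_rewrite (mulE a).
  nf_rewrite (whiskerl (S a) (mulE a)).
  nf_rewrite (interchange (f a) (calg_mul T a)).
  have /cl_eqs := assT a; nf => n; rewrite_vc n.
  nf_rewrite (mulE a); nf_rewrite (esym (interchange (calg_mul S a) (f a))).
  by nf_rewrite (whiskerr (T a) (mulE a)).
move=> a; have uE' := congr1 (@cl _ _ _ _ _ _) (unitf a).
have [/cl_eqs + /cl_eqs] := neuT a; nf => n1 n2.
split; apply/cl_eqs; cancel_iso (f a); nf; nf_rewrite (mulE a).
  nf_rewrite (esym (interchange (calg_unit S a) (f a))).
  nf_rewrite (whiskerr (T a) uE').
  by rewrite (vc_rewrite2 n1); drop_ids.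
nf_rewrite (whiskerl (S a) uE').
nf_rewrite (interchange (f a) (calg_unit T a)).
by rewrite (vc_rewrite2 n2); drop_ids.
Qed.

Lemma calg_hom_inv (S T : calg_data B) (f : forall a : B, iso (S a) (T a)) :
  is_calg_hom f -> is_calg_hom (fun a => bwd (f a)).
Proof.
case=> hbf mulf unitf; split=> [a b X|a|a].
- have e : hb1 T X = (idm X ⊚ f a) • (hb1 S X • (bwd (f b) ⊚ idm X)).
    by rewrite compA hbf -compA -hcomp_comp bwdK comp1m hcomp_id compm1.
  by rewrite e compA -hcomp_comp fwdK comp1m hcomp_id comp1m.
- have e : calg_mul T a = f a • (calg_mul S a • (bwd (f a) ⊚ bwd (f a))).
    by rewrite compA mulf -compA -hcomp_comp bwdK hcomp_id compm1.
  by rewrite e compA fwdK comp1m.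
by rewrite -unitf compA fwdK comp1m.
Qed.

Lemma universal_action_uniq (a b : B) (S Z : cells a a)
    (act : forall Y : cells a b, hom (Y ∘ S) Y) (f g : hom Z S) :
  universal_action act ->
  (forall Y, act Y • (idm Y ⊚ f) = act Y • (idm Y ⊚ g)) -> f = g.
Proof.
move=> [nat univ] e.
have [|h [_ uh]] := univ Z (fun Y => act Y • (idm Y ⊚ f)).
  move=> Y Y' h; rewrite compA nat -!compA; congr (_ • _).
  by apply: cl_inj; nf; nf_rewrite (interchange h f).
by rewrite -(uh f) // -(uh g).
Qed.

(** The universal maps between [S] and [T] are mutually inverse. Multiplications and units are
    compared by uniqueness of universal maps, half-braidings by its whiskered form
    [universal_action_monic]. *)
Lemma adjoint_action_unique (D : forall (a b : B) (X : cells a b), dual_data X)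
    (D_dual : forall (a b : B) (X : cells a b), is_left_dual (D a b X))
    (b : B) (S T : calg_data B)
    (actS : forall (a : B) (Y : cells a b), hom (Y ∘ S a) Y)
    (actT : forall (a : B) (Y : cells a b), hom (Y ∘ T a) Y) :
  adjoint_action actS -> adjoint_action actT -> is_center_algebra T ->
  isomorphic_center_algebras S T.
Proof.
move=> [uS hS mS eS] [uT hT mT eT] Talg.
have ex (Z U : forall a, cells a a)
    (actZ : forall (a : B) (Y : cells a b), hom (Y ∘ Z a) Y)
    (actU : forall (a : B) (Y : cells a b), hom (Y ∘ U a) Y) a :
    universal_action (actZ a) -> universal_action (actU a) ->
    {h : hom (Z a) (U a) | forall Y, actU a Y • (idm Y ⊚ h) = actZ a Y}.
  move=> [nZ _] [_ univ]; apply: cid.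
  by have [h [hP _]] := univ _ _ nZ; exists h.
have inv (Z U : forall a, cells a a)
    (actZ : forall (a : B) (Y : cells a b), hom (Y ∘ Z a) Y)
    (actU : forall (a : B) (Y : cells a b), hom (Y ∘ U a) Y) a
    (uZ : universal_action (actZ a)) (uU : universal_action (actU a)) :
    sval (ex U Z actU actZ a uU uZ) • sval (ex Z U actZ actU a uZ uU) = idm (Z a).
  case: (ex U Z _ _ _ _ _) => g gP; case: (ex Z U _ _ _ _ _) => f fP /=.
  apply: (universal_action_uniq uZ) => Y.
  rewrite hcomp_id compm1 -(comp1m (idm Y)) hcomp_comp compA gP.
  exact: fP.
pose f a := Iso (inv _ _ _ _ a (uS a) (uT a)) (inv _ _ _ _ a (uT a) (uS a)).
have fP a Y : cl (actT a Y) * ('1_Y ⊠ cl (f a)) = cl (actS a Y).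
  by rewrite -cl_hcomp -cl_comp /=; case: (ex _ _ _ _ _ _ _) => h /= ->.
have fhom : is_calg_hom f.
  split=> [a c X|a|a].
  - have [[isoT _ _ _] _ _ _ _] := Talg; have [i iE] := isoT _ _ X.
    (* Cancelling the half-braiding of [T] gives both sides the target [T c ∘ X], as
       [universal_action_monic] requires. *)
    suff e : bwd i • ((idm X ⊚ f a) • hb1 S X) = f c ⊚ idm X.
      by rewrite iE -e compA bwdK comp1m.
    apply: (universal_action_monic (uT c) (D_dual a c X)) => Y.
    rewrite {1}hT; nf.
    have iVK : cl (hb1 T X) * cl (bwd i) = '1_(X ∘ T a) by rewrite iE iso_vcVK.
    nf_rewrite (whiskerl Y iVK); nf_rewrite (fP a (Y ∘ X)); rewrite -hS.
    by nf_rewrite (whiskerr X (fP c Y)).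
  - apply: (universal_action_uniq (uT a)) => Y; apply: cl_inj; nf.
    rewrite (hc_split (f a) (f a)); nf; rewrite_vc (fP a Y); rewrite_vc (mT a Y).
    nf_rewrite (whiskerr (T a) (fP a Y)); rewrite mS.
    nf_rewrite (interchange (actS a Y) (f a)).
    by rewrite_vc (fP a Y).
  apply: (universal_action_uniq (uT a)) => Y; apply: cl_inj; nf.
  by rewrite_vc (fP a Y); rewrite eS eT.
split=> //; first exact: center_algebra_transport Talg fhom.
exists f, (fun a => bwd (f a)); split=> // [|a|a]; first exact: calg_hom_inv.
  exact: fwdK.
exact: bwdK.
Qed.
End Transport.

(** * Adjoint equivalences and local equivalences *)

Section AdjointEquivalence.
Variables (k : fieldType) (B : twocat k) (a b : B).
Variables (f : cells a b) (g : cells b a).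
Variables (e : iso (g ∘ f) (id1 a)) (w : iso (f ∘ g) (id1 b)).

(** The standard correction of [bwd e]: unlike [bwd e] in general, it satisfies both triangle
    identities with counit [w]. *)
Definition adj_unit : hom (id1 a) (g ∘ f) :=
  idm (g ∘ f)
  ⊙ (e ⊚ idm (g ∘ f))
  ⊙ (idm g ⊚ bwd w ⊚ idm f)
  ⊙ bwd e.

Definition adj_unit_inv : hom (g ∘ f) (id1 a) :=
  e
  ⊙ (idm g ⊚ w ⊚ idm f)
  ⊙ (bwd e ⊚ idm (g ∘ f))
  ⊙ idm (g ∘ f).

Lemma cl_adj_unit : cl adj_unit
  = (cl e ⊠ '1_g ⊠ '1_f) * (('1_g ⊠ cl (bwd w) ⊠ '1_f) * cl (bwd e)).
Proof. by rewrite /adj_unit; nf. Qed.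

Lemma cl_adj_unit_inv : cl adj_unit_inv
  = cl e * (('1_g ⊠ cl w ⊠ '1_f) * (cl (bwd e) ⊠ '1_g ⊠ '1_f)).
Proof. by rewrite /adj_unit_inv; nf. Qed.

Lemma adj_unitK : cl adj_unit_inv * cl adj_unit = '1_(id1 a).
Proof.
rewrite cl_adj_unit cl_adj_unit_inv !vcA.
nf_rewrite (whiskerr (g ∘ f) (iso_vcK e)).
nf_rewrite (whisker g f (iso_vcVK w)).
exact: iso_vcVK.
Qed.

Lemma adj_unitVK : cl adj_unit * cl adj_unit_inv = '1_(g ∘ f).
Proof.
rewrite cl_adj_unit cl_adj_unit_inv !vcA.
nf_rewrite (iso_vcK e).
nf_rewrite (whisker g f (iso_vcK w)).
by nf_rewrite (whiskerr (g ∘ f) (iso_vcVK e)).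
Qed.

(* Both sides agree after composing with [e], which is invertible. *)
Lemma whisker_iso_swapl : cl e ⊠ '1_g ⊠ '1_f = '1_g ⊠ '1_f ⊠ cl e.
Proof. by cancel_iso e; nf_rewrite (interchange e e). Qed.

Lemma whisker_iso_swapr : cl w ⊠ '1_f ⊠ '1_g = '1_f ⊠ '1_g ⊠ cl w.
Proof. by cancel_iso w; nf_rewrite (interchange w w). Qed.

(** Interchange brings [w] next to the whiskered [bwd w], but on the wrong factor [f ∘ g];
    [whisker_iso_swapr] moves it to where the two cancel. *)
Lemma adj_triangle_l : ('1_g ⊠ cl w) * (cl adj_unit ⊠ '1_g) = '1_g.
Proof.
rewrite cl_adj_unit; nf.
nf_rewrite (esym (interchange e (idm g ⊚ w))).
nf_rewrite (whiskerl g (esym whisker_iso_swapr)).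
nf_rewrite (whisker g (f ∘ g) (iso_vcVK w)).
by nf_rewrite (whiskerr g (iso_vcVK e)).
Qed.

Lemma adj_triangle_r : (cl w ⊠ '1_f) * ('1_f ⊠ cl adj_unit) = '1_f.
Proof.
rewrite cl_adj_unit; nf.
nf_rewrite (whiskerl f whisker_iso_swapl).
nf_rewrite (interchange w (idm f ⊚ e)).
nf_rewrite (whiskerr f whisker_iso_swapr).
nf_rewrite (whisker (f ∘ g) f (iso_vcVK w)).
by nf_rewrite (whiskerl f (iso_vcVK e)).
Qed.

Lemma whiskerr_faithful (c : B) (X X' : cells b c) (h h' : hom X X') :
  h ⊚ idm f = h' ⊚ idm f -> h = h'.
Proof.
move=> E.
(* [u] is recovered from [u ⊚ idm f] by whiskering with [g] and conjugating by [w]. *)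
have wE (u : hom X X') : cl u
    = ('1_X' ⊠ cl w) * ((cl (u ⊚ idm f) ⊠ '1_g) * ('1_X ⊠ cl (bwd w))).
  nf; nf_rewrite (interchange u (bwd w)).
  by nf_rewrite (whiskerl X' (iso_vcVK w)).
by apply: cl_inj; rewrite (wE h) (wE h') E.
Qed.

Lemma whiskerl_faithful (c : B) (X X' : cells c a) (h h' : hom X X') :
  idm f ⊚ h = idm f ⊚ h' -> h = h'.
Proof.
move=> E.
have wE (u : hom X X') : cl u
    = (cl e ⊠ '1_X') * (('1_g ⊠ cl (idm f ⊚ u)) * (cl (bwd e) ⊠ '1_X)).
  nf; nf_rewrite (interchange e u).
  by nf_rewrite (whiskerr X (iso_vcVK e)).
by apply: cl_inj; rewrite (wE h) (wE h') E.
Qed.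

Lemma whiskerr_full (c : B) (X X' : cells b c) (h : hom (X ∘ f) (X' ∘ f)) :
  exists u : hom X X', u ⊚ idm f = h.
Proof.
exists (idm X' ⊙ ((idm X' ⊚ w) ⊙ ((h ⊚ idm g) ⊙ ((idm X ⊚ bwd w) ⊙ idm X)))).
apply: cl_inj; nf.
have := adj_triangle_r; move: adj_unit => eta tri.
(* The triangle identity turns [bwd w] on the left of [f] into the unit on its right, where it
   slides past [h]. *)
have wE : cl (bwd w) ⊠ '1_f = '1_f ⊠ cl eta.
  cancel_iso (iso_hcomp w (iso_id f)); nf; rewrite tri.
  by nf_rewrite (whiskerr f (iso_vcVK w)).
nf_rewrite (whiskerl X wE); nf_rewrite (interchange h eta).
by nf_rewrite (whiskerl X' tri).
Qed.

End AdjointEquivalence.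

(** * Biequivalences are equivalences on hom-categories *)

Section LocalEquivalence.
Variable k : fieldType.

Definition equivalence1 (B : twocat k) (a b : B) (x : cells a b) : Prop :=
  exists y : cells b a,
    inhabited (iso (y ∘ x) (id1 a)) /\ inhabited (iso (x ∘ y) (id1 b)).

Section IdentityLike.
Variables (B : twocat k) (H : pf_data B B) (x : pn_data H (pf_id B)).
Hypothesis x_nat : forall (a b : B) (X X' : cells a b) (f : hom X X'),
  (idm (x b) ⊚ fmap (pf1 H) f) • pn1 x X = pn1 x X' • (f ⊚ idm (x a)).
Hypothesis x_eq : forall a : B, equivalence1 (x a).

(** Naturality identifies [f ⊚ idm (x a)] with [idm (x b) ⊚ fmap (pf1 H) f] up to the invertible
    cells of [x], and whiskering by an equivalence is faithful. *)
Lemma pn_id_faithful (a b : B) (X X' : cells a b) (f f' : hom X X') :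
  fmap (pf1 H) f = fmap (pf1 H) f' -> f = f'.
Proof.
move=> E; have [y [[e] [w]]] := x_eq a; apply: (whiskerr_faithful w).
rewrite -[LHS]comp1m -(fwdK (pn1 x X')) -compA -x_nat E.
by rewrite x_nat compA fwdK comp1m.
Qed.

Lemma pn_id_full (a b : B) (X X' : cells a b)
    (h : hom (pf1 H X) (pf1 H X')) : exists f : hom X X', fmap (pf1 H) f = h.
Proof.
have [y [[e] [w]]] := x_eq a; have [z [[e'] [w']]] := x_eq b.
have [f fE] := whiskerr_full e w
  (bwd (pn1 x X') • ((idm (x b) ⊚ h) • pn1 x X)).
exists f; apply: (whiskerl_faithful e').
have := x_nat f; rewrite fE !compA (bwdK (pn1 x X')) comp1m => E.
by rewrite -[LHS]compm1 -(bwdK (pn1 x X)) compA E -compA bwdK compm1.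
Qed.

Lemma pn_id_surj (a b : B) (Z : cells (H a) (H b)) :
  exists X : cells a b, inhabited (iso (pf1 H X) Z).
Proof.
have [y [[e] [w]]] := x_eq a; have [z [[e'] [w']]] := x_eq b.
(* Writing [X] for this 1-cell, [pf1 H X] is isomorphic to [z ∘ x b ∘ pf1 H X], hence to
   [z ∘ X ∘ x a], hence to [Z]. *)
exists (x b ∘ Z ∘ y).
have s1 := pn1 x (x b ∘ Z ∘ y).
have s2 := iso_hcomp (iso_id z) s1.
have s3 : iso (z ∘ (x b ∘ pf1 H (x b ∘ Z ∘ y))) (pf1 H (x b ∘ Z ∘ y)).
  rewrite comp1A -[X in iso _ X]comp11X.
  exact: iso_hcomp e' (iso_id _).
have s4 : iso (z ∘ (x b ∘ Z ∘ y ∘ x a)) Z.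
  rewrite -[X in iso _ X]comp1X1 -[X in iso _ (X ∘ _)]comp11X -!comp1A comp1A.
  exact: iso_hcomp e' (iso_hcomp (iso_id _) e).
exact: inhabits (iso_comp s4 (iso_comp (iso_inv s2) (iso_inv s3))).
Qed.

End IdentityLike.

Definition loc_faithful (B B' : twocat k) (F : pf_data B B') : Prop :=
  forall (a b : B) (X X' : cells a b) (f f' : hom X X'),
    fmap (pf1 F) f = fmap (pf1 F) f' -> f = f'.

Definition loc_full (B B' : twocat k) (F : pf_data B B') : Prop :=
  forall (a b : B) (X X' : cells a b) (h : hom (pf1 F X) (pf1 F X')),
    exists f : hom X X', fmap (pf1 F) f = h.

Definition loc_surj (B B' : twocat k) (F : pf_data B B') : Prop :=
  forall (a b : B) (Z : cells (F a) (F b)),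
    exists X : cells a b, inhabited (iso (pf1 F X) Z).

Lemma pn_equivalence (B : twocat k) (H : pf_data B B)
    (x : pn_data H (pf_id B)) (y : pn_data (pf_id B) H) :
  pn_iso (pn_comp y x) (pn_id H) -> pn_iso (pn_comp x y) (pn_id (pf_id B)) ->
  forall a, equivalence1 (x a).
Proof.
case=> e _ [w _] a; exists (y a).
by split; [exact: inhabits (e a) | exact: inhabits (w a)].
Qed.

(** Both composites of [F] and [G] are locally fully faithful, so [F] and [G] are faithful, and then
    each is full because the other is faithful. *)
Lemma biequivalence_local (B B' : twocat k) (F : pf_data B B')
    (G : quasi_inverse F) : [/\ loc_faithful F, loc_full F & loc_surj F].
Proof.
have [x [y [[x_nat _ _] _ yx xy]]] := qi_left G.
have x_eq := pn_equivalence yx xy.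
have [c_nat _ _] := qi_chiP G.
have c_eq a : equivalence1 (qi_chi G a).
  exists (qi_tau G a); split; first exact: inhabits (qi_omega G a).
  exact: inhabits (qi_epsilon G a).
have Ffaith : loc_faithful F.
  move=> a b X X' f f' E; apply: (pn_id_faithful x_nat x_eq).
  by rewrite /= E.
have Gfaith : loc_faithful G.
  move=> a b X X' f f' E; apply: (pn_id_faithful c_nat c_eq).
  by rewrite /= E.
have Gfull : loc_full G.
  move=> a b X X' h.
  have [f fE] := pn_id_full c_nat c_eq (fmap (pf1 F) h).
  by exists f; apply: Ffaith.
split=> // [a b X X' h|a b Z].
  have [f fE] := pn_id_full x_nat x_eq (fmap (pf1 G) h).
  by exists f; apply: Gfaith.
(* The isomorphism from [pf1 G (pf1 F X)] to [pf1 G Z] lifts along the fully faithful [G]. *)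
have [X [i]] := pn_id_surj x_eq (pf1 G Z); exists X.
have [f fE] := Gfull _ _ _ _ i; have [f' f'E] := Gfull _ _ _ _ (bwd i).
have fK : f' • f = idm (pf1 F X) by apply: Gfaith; rewrite fmap_comp fE f'E fwdK fmap_id.
have fVK : f • f' = idm Z by apply: Gfaith; rewrite fmap_comp fE f'E bwdK fmap_id.
exact: inhabits (Iso fK fVK).
Qed.

End LocalEquivalence.

(** * The action transported along F *)

(** This reduces statements about actions on all 1-cells to those in the image of [F]. *)
Lemma natural_action_iso (k : fieldType) (B : twocat k) (a b : B) (Z : cells a a)
    (t : forall Y : cells a b, hom (Y ∘ Z) Y) (X Y : cells a b) (i : iso X Y) :
  natural_action t -> cl (t Y) = cl i * (cl (t X) * (cl (bwd i) ⊠ '1_Z)).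
Proof.
move=> nat; rewrite -vcA -(cl_comp i) nat; nf.
by nf_rewrite (whiskerr Z (iso_vcVK i)).
Qed.

Section TransportedAction.
Variables (k : fieldType) (B B' : twocat k) (F : pf_data B B').

(** Equations between packed cells, hence up to strictness, can thus be applied under [fmap]. *)
Lemma fmap_cl (a b : B) (X Y X' Y' : cells a b) (f : hom X Y) (f' : hom X' Y') :
  cl f = cl f' -> cl (fmap (pf1 F) f) = cl (fmap (pf1 F) f').
Proof.
move=> E.
have [eX eY] := congr1 (fun p : cell2 a b =>
  if p is Some (existT U (existT V _)) then (U, V) else (X, Y)) E.
case: X' / eX f' E => f' E; case: Y' / eY f' E => f' E.
by rewrite (cl_inj E).
Qed.

Hypotheses (Fpf : is_pseudofunctor F) (Ffaith : loc_faithful F)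
  (Ffull : loc_full F) (Fsurj : loc_surj F).

Lemma alpha_nat (a b c : B) (X X' : cells b c) (Y Y' : cells a b)
    (f : hom X X') (g : hom Y Y') :
  cl (alpha F X' Y') * (cl (fmap (pf1 F) f) ⊠ cl (fmap (pf1 F) g))
  = cl (fmap (pf1 F) (f ⊚ g)) * cl (alpha F X Y).
Proof. by case: Fpf => n _ _ _; rewrite -cl_hcomp -!cl_comp n. Qed.

Lemma alphaA (a b c d : B) (X : cells c d) (Y : cells b c) (Z : cells a b) :
  cl (alpha F X (Y ∘ Z)) * ('1_(pf1 F X) ⊠ cl (alpha F Y Z))
  = cl (alpha F (X ∘ Y) Z) * (cl (alpha F X Y) ⊠ '1_(pf1 F Z)).
Proof. by case: Fpf => _ n _ _; have /cl_eqs := n _ _ _ _ X Y Z; nf. Qed.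

Lemma alphaX1 (a b : B) (X : cells a b) :
  cl (alpha F X (id1 a)) * ('1_(pf1 F X) ⊠ cl (phi F a)) = '1_(pf1 F X).
Proof. by case: Fpf => _ _ _ n; have /cl_eqs := n _ _ X; nf. Qed.

Lemma fmap_comps (a b : B) (X Y Y' Z : cells a b) (g : hom Y' Z) (f : hom X Y)
    (e : Y = Y') :
  cl (fmap (pf1 F) (comps g f e)) = cl (fmap (pf1 F) g) * cl (fmap (pf1 F) f).
Proof. by case: Y' / e g => g; rewrite -cl_comp -fmap_comp /comps /= comp1m. Qed.

Lemma alpha_natl (a b c : B) (X : cells b c) (Y Y' : cells a b) (g : hom Y Y') :
  cl (alpha F X Y') * ('1_(pf1 F X) ⊠ cl (fmap (pf1 F) g))
  = cl (fmap (pf1 F) (idm X ⊚ g)) * cl (alpha F X Y).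
Proof. by rewrite -fmap_id alpha_nat. Qed.

Lemma alpha_natr (a b c : B) (X X' : cells b c) (Y : cells a b) (f : hom X X') :
  cl (alpha F X' Y) * (cl (fmap (pf1 F) f) ⊠ '1_(pf1 F Y))
  = cl (fmap (pf1 F) (f ⊚ idm Y)) * cl (alpha F X Y).
Proof. by rewrite -[idm (pf1 F Y)]fmap_id alpha_nat. Qed.

Lemma alphaA_inv (a b c d : B) (X : cells c d) (Y : cells b c) (Z : cells a b) :
  cl (alpha F (X ∘ Y) Z) * ((cl (alpha F X Y) ⊠ '1_(pf1 F Z))
    * ('1_(pf1 F X) ⊠ cl (bwd (alpha F Y Z)))) = cl (alpha F X (Y ∘ Z)).
Proof.
rewrite -vcA -alphaA vcA.
by nf_rewrite (whiskerl (pf1 F X) (iso_vcVK (alpha F Y Z))).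
Qed.

Variables (b : B) (S : forall a : B, cells a a)
  (act : forall (a : B) (Y : cells a b), hom (Y ∘ S a) Y).
Hypothesis act_univ : forall a, universal_action (@act a).

(** The action is prescribed on the image of [F] and extended by conjugation with chosen
    isomorphisms [pf1 F X -> W]. *)
Lemma transported_natural_action :
  exists beta : forall (a : B) (W : cells (F a) (F b)), hom (W ∘ pf1 F (S a)) W,
    (forall a, natural_action (beta a)) /\
    forall (a : B) (X : cells a b),
      beta a (pf1 F X) = fmap (pf1 F) (act X) • alpha F X (S a).
Proof.
have cho (a : B) (W : cells (F a) (F b)) :
    {X : cells a b & iso (pf1 F X) W}.
  have [X iX] := cid (Fsurj W); exists X.
  have [|i _] := @cid (iso (pf1 F X) W) (fun _ => True); last exact: i.
  by case: iX => i; exists i.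
pose beta a W : hom (W ∘ pf1 F (S a)) W :=
  let: existT X i := cho a W in
  i • (fmap (pf1 F) (act X) • (alpha F X (S a) • (bwd i ⊚ idm (pf1 F (S a))))).
(* Fullness lifts [bwd i • h] to [B], where [act] is natural. The case of an identity [h] shows that
   the choice of isomorphism is immaterial. *)
have key (a : B) (X : cells a b) (W : cells (F a) (F b)) (h : hom (pf1 F X) W) :
    h • (fmap (pf1 F) (act X) • alpha F X (S a))
    = beta a W • (h ⊚ idm (pf1 F (S a))).
  rewrite /beta; case: (cho a W) => X' i.
  have [f fE] := Ffull (bwd i • h).
  have hE : h = i • fmap (pf1 F) f by rewrite fE compA bwdK comp1m.
  have [nat _] := act_univ a.
  rewrite {1}hE -!compA; congr (_ • _); rewrite compA -fmap_comp nat.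
  rewrite fmap_comp -!compA; congr (_ • _).
  rewrite -hcomp_comp -fE compm1.
  apply: cl_inj; rewrite !cl_comp -alpha_nat fmap_id //.
exists beta; split=> [a W W' h|a X].
  rewrite [X in _ • X = _]/beta; case: (cho a W) => X i.
  have -> : fmap (pf1 F) (act X) • (alpha F X (S a) • (bwd i ⊚ idm (pf1 F (S a))))
    = (fmap (pf1 F) (act X) • alpha F X (S a)) • (bwd i ⊚ idm (pf1 F (S a))).
    exact: compA.
  rewrite compA compA key -compA -hcomp_comp comp1m; congr (_ • (_ ⊚ _)).
  by rewrite -compA bwdK compm1.
by have := key a X _ (idm _); rewrite hcomp_id comp1m compm1 => ->.
Qed.

Variable beta : forall (a : B) (W : cells (F a) (F b)), hom (W ∘ pf1 F (S a)) W.
Hypothesis beta_nat : forall a, natural_action (@beta a).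
Hypothesis betaF : forall (a : B) (X : cells a b),
  beta (pf1 F X) = fmap (pf1 F) (act X) • alpha F X (S a).

Lemma transported_universal_action (a : B) : universal_action (@beta a).
Proof.
split=> // Z t t_nat.
have [Z0 [z]] := Fsurj Z.
(* Fullness lifts [t], restricted to the image of [F], to an action of [Z0]; faithfulness will make
   it natural. *)
have [t0 t0P] : exists t0 : forall X : cells a b, hom (X ∘ Z0) X, forall X,
    fmap (pf1 F) (t0 X) • alpha F X Z0 = t (pf1 F X) • (idm (pf1 F X) ⊚ z).
  have ex X := cid (Ffull ((t (pf1 F X) • (idm (pf1 F X) ⊚ z)) • bwd (alpha F X Z0))).
  exists (fun X => sval (ex X)) => X; case: (ex X) => u /= ->.
  by rewrite -compA fwdK compm1.
have t0_nat : natural_action t0.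
  move=> X X' f; apply: Ffaith.
  rewrite -[LHS]compm1 -[RHS]compm1 -(bwdK (alpha F X Z0)) !compA.
  congr (_ • _); rewrite !fmap_comp -!compA t0P.
  rewrite compA t_nat.
  have -> : fmap (pf1 F) (f ⊚ idm Z0) • alpha F X Z0
    = alpha F X' Z0 • (fmap (pf1 F) f ⊚ idm (pf1 F Z0)).
    by apply: cl_inj; rewrite !cl_comp -alpha_nat fmap_id.
  rewrite compA t0P -!compA; congr (_ • _).
  by rewrite -!hcomp_comp !comp1m !compm1.
have actF (h0 : hom Z0 (S a)) X :
  fmap (pf1 F) (act X • (idm X ⊚ h0)) • alpha F X Z0
  = beta (pf1 F X) • (idm (pf1 F X) ⊚ fmap (pf1 F) h0).
  rewrite betaF fmap_comp -!compA; congr (_ • _).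
  by apply: cl_inj; rewrite !cl_comp -alpha_nat fmap_id.
have [_ univ] := act_univ a; have [h0 [h0P h0U]] := univ _ _ t0_nat.
(* By naturality of both actions, the defining equation need only be checked on the image of [F]. *)
have Fred (h : hom Z (pf1 F (S a))) :
    (forall X, beta (pf1 F X) • (idm (pf1 F X) ⊚ h) = t (pf1 F X)) ->
    forall W, beta W • (idm W ⊚ h) = t W.
  move=> hP W; have [X [i]] := Fsurj W; have := hP X.
  move=> /(congr1 (@cl _ _ _ _ _ _)); nf => hX.
  apply: cl_inj; rewrite (natural_action_iso i t_nat) -hX; nf.
  rewrite (natural_action_iso i (@beta_nat a)); nf.
  by nf_rewrite (interchange (bwd i) h).
exists (fmap (pf1 F) h0 • bwd z); split=> [W|h' h'P].
  apply: Fred => X.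
  rewrite -[idm (pf1 F X)]comp1m hcomp_comp compA -actF h0P t0P -compA.
  by rewrite -hcomp_comp bwdK comp1m hcomp_id compm1.
(* Another solution lifts to [B], where uniqueness holds. *)
have [h1 h1E] := Ffull (h' • z).
suff -> : h0 = h1 by rewrite h1E -compA bwdK compm1.
apply: h0U => X; apply: Ffaith.
rewrite -[LHS]compm1 -[RHS]compm1 -(bwdK (alpha F X Z0)) !compA; congr (_ • _).
rewrite actF t0P h1E -h'P -compA; congr (_ • _).
by rewrite -hcomp_comp comp1m.
Qed.


Lemma transported_braid
    (hb : forall (a c : B) (X : cells a c), hom (S c ∘ X) (X ∘ S a)) :
  (forall (a c : B) (X : cells a c) (Y : cells c b),
    cl (act Y) ⊠ '1_X = cl (act (Y ∘ X)) * ('1_Y ⊠ cl (hb a c X))) ->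
  forall (a c : B) (X : cells a c) (W : cells (F c) (F b)),
  cl (beta W) ⊠ '1_(pf1 F X)
  = cl (beta (W ∘ pf1 F X))
    * ('1_W ⊠ (cl (bwd (alpha F X (S a)))
        * (cl (fmap (pf1 F) (hb a c X)) * cl (alpha F (S c) X)))).
Proof.
move=> hbP a c X W; have [U [i]] := Fsurj W.
rewrite (natural_action_iso i (@beta_nat c)).
(* [j] presents [W ∘ pf1 F X] as isomorphic to [pf1 F (U ∘ X)], where [betaF] computes the
   action. *)
pose j := iso_comp (iso_hcomp i (iso_id (pf1 F X))) (iso_inv (alpha F U X)).
rewrite (natural_action_iso j (@beta_nat a)) {}/j.
rewrite !betaF; nf.
pose m : hom (pf1 F (S c) ∘ pf1 F X) (pf1 F X ∘ pf1 F (S a)) :=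
  bwd (alpha F X (S a)) • (fmap (pf1 F) (hb a c X) • alpha F (S c) X).
nf_rewrite (interchange (bwd i) m); rewrite /=.
nf_rewrite (alphaA_inv U X (S a)).
nf_rewrite (alpha_natl U (hb a c X)).
nf_rewrite (alphaA U (S c) X).
have e : cl (fmap (pf1 F) (act (U ∘ X))) * cl (fmap (pf1 F) (idm U ⊚ hb a c X))
    = cl (fmap (pf1 F) (act U ⊚ idm X)).
  rewrite -(fmap_comps _ _ (comp1A U X (S a))); apply: fmap_cl.
  by rewrite cl_hcomp hbP; nf.
rewrite_vc e; nf_rewrite (esym (alpha_natr X (act U))).
by nf_rewrite (iso_vcK (alpha F U X)).
Qed.

Lemma transported_mul (mul : forall a, hom (S a ∘ S a) (S a)) :
  (forall (a : B) (Y : cells a b),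
    cl (act Y) * ('1_Y ⊠ cl (mul a)) = cl (act Y) * (cl (act Y) ⊠ '1_(S a))) ->
  forall (a : B) (W : cells (F a) (F b)),
  cl (beta W) * ('1_W ⊠ (cl (fmap (pf1 F) (mul a)) * cl (alpha F (S a) (S a))))
  = cl (beta W) * (cl (beta W) ⊠ '1_(pf1 F (S a))).
Proof.
move=> mulP a W; have [U [i]] := Fsurj W.
rewrite (natural_action_iso i (@beta_nat a)) !betaF; nf.
nf_rewrite (interchange (bwd i) (fmap (pf1 F) (mul a) • alpha F (S a) (S a))).
nf_rewrite (alpha_natl U (mul a)).
nf_rewrite (alphaA U (S a) (S a)).
nf_rewrite (whiskerr (pf1 F (S a)) (iso_vcK i)).
nf_rewrite (alpha_natr (S a) (act U)).
have e : cl (fmap (pf1 F) (act U)) * cl (fmap (pf1 F) (idm U ⊚ mul a))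
    = cl (fmap (pf1 F) (act U)) * cl (fmap (pf1 F) (act U ⊚ idm (S a))).
  rewrite -(fmap_comps (act U) (idm U ⊚ mul a) erefl).
  rewrite -(fmap_comps (act U) (act U ⊚ idm (S a)) erefl).
  by apply: fmap_cl; rewrite !cl_comps !cl_hcomp mulP.
by rewrite_vc e.
Qed.

Lemma transported_unit (unit : forall a, hom (id1 a) (S a)) :
  (forall (a : B) (Y : cells a b), cl (act Y) * ('1_Y ⊠ cl (unit a)) = '1_Y) ->
  forall (a : B) (W : cells (F a) (F b)),
  cl (beta W) * ('1_W ⊠ (cl (fmap (pf1 F) (unit a)) * cl (phi F a))) = '1_W.
Proof.
move=> unitP a W; have [U [i]] := Fsurj W.
rewrite (natural_action_iso i (@beta_nat a)) !betaF; nf.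
nf_rewrite (interchange (bwd i) (fmap (pf1 F) (unit a) • phi F a)).
nf_rewrite (alpha_natl U (unit a)).
nf_rewrite (alphaX1 U).
have e : cl (fmap (pf1 F) (act U)) * cl (fmap (pf1 F) (idm U ⊚ unit a)) = '1_(pf1 F U).
  rewrite -(fmap_comps (act U) (idm U ⊚ unit a) erefl) -fmap_id.
  by apply: fmap_cl; rewrite cl_comps cl_hcomp unitP.
by rewrite_vc e; drop_ids; apply: iso_vcVK.
Qed.

End TransportedAction.

(** * The action conjugated by an equivalence *)

Section ConjugateAction.
Variables (k : fieldType) (B : twocat k) (c K d : B).
Variables (chi : cells K c) (tau : cells c K).
Variables (e : iso (chi ∘ tau) (id1 c)) (w : iso (tau ∘ chi) (id1 K)).
Variables (R : cells K K) (beta : forall W : cells K d, hom (W ∘ R) W).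

(** [R] acts on [Y ∘ chi], after which [chi ∘ tau] is cancelled. Using [adj_unit_inv] instead of [e]
    makes this compatible with [w], which enters the multiplication. *)
Definition conj_act (Y : cells c d) : hom (Y ∘ (chi ∘ R ∘ tau)) Y :=
  idm Y ⊙ (idm Y ⊚ adj_unit_inv e w) ⊙ (beta (Y ∘ chi) ⊚ idm tau)
    ⊙ idm (Y ∘ (chi ∘ R ∘ tau)).

Lemma cl_conj_act (Y : cells c d) :
  cl (conj_act Y)
  = ('1_Y ⊠ cl (adj_unit_inv e w)) * (cl (beta (Y ∘ chi)) ⊠ '1_tau).
Proof. by rewrite /conj_act; move: (adj_unit_inv e w) => ?; nf. Qed.

Lemma adj_inv_l : cl (adj_unit_inv e w) ⊠ '1_chi = '1_chi ⊠ cl w.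
Proof.
have := adj_triangle_l e w; have := adj_unitVK e w.
move: (adj_unit e w) (adj_unit_inv e w) => u v E tri.
have := congr1 (fun p => p * (cl v ⊠ '1_chi)) tri; nf => <-.
by nf_rewrite (whiskerr chi E).
Qed.

Lemma adj_inv_r : '1_tau ⊠ cl (adj_unit_inv e w) = cl w ⊠ '1_tau.
Proof.
have := adj_triangle_r e w; have := adj_unitVK e w.
move: (adj_unit e w) (adj_unit_inv e w) => u v E tri.
have := congr1 (fun p => p * ('1_tau ⊠ cl v)) tri; nf => <-.
by nf_rewrite (whiskerl tau E).
Qed.

Lemma conj_act_universal : universal_action beta -> universal_action conj_act.
Proof.
have := adj_triangle_l e w; have := adj_triangle_r e w.
have := adj_inv_r; have := adj_unitK e w; have := cl_conj_act.
move: conj_act (adj_unit e w) (adj_unit_inv e w) => act u v actE vu inv_r tri_r tri_l uni.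
have [nat univ] := uni.
have act_nat : natural_action act.
  move=> Y Y' f; apply: cl_inj; rewrite !cl_comp !actE; nf.
  nf_rewrite (interchange f v).
  have := congr1 (@cl _ _ _ _ _ _) (nat _ _ (f ⊚ idm chi)); nf => n.
  by nf_rewrite (whiskerr tau n).
split=> // Z t t_nat.
(* A family acting on the 1-cells [c -> d] yields one acting on [K -> d]. *)
have [s sE] : exists s : forall W, hom (W ∘ (tau ∘ Z ∘ chi)) W,
    forall W, cl (s W) = ('1_W ⊠ cl w) * (cl (t (W ∘ tau)) ⊠ '1_chi).
  exists (fun W => idm W ⊙ (idm W ⊚ w) ⊙ (t (W ∘ tau) ⊚ idm chi)
                     ⊙ idm (W ∘ (tau ∘ Z ∘ chi))) => W.
  by nf.
have s_nat : natural_action s.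
  move=> W W' f; apply: cl_inj; rewrite !cl_comp !sE; nf.
  nf_rewrite (interchange f w).
  have := congr1 (@cl _ _ _ _ _ _) (t_nat _ _ (f ⊚ idm tau)); nf => n.
  by nf_rewrite (whiskerr chi n).
have [h1 [h1P _]] := univ _ _ s_nat.
have h1E W : cl (beta W) * ('1_W ⊠ cl h1)
    = ('1_W ⊠ cl w) * (cl (t (W ∘ tau)) ⊠ '1_chi).
  by rewrite -sE -h1P; nf.
have split_u : cl u ⊠ '1_Z ⊠ cl u
    = (cl u ⊠ '1_Z ⊠ '1_chi ⊠ '1_tau) * ('1_Z ⊠ cl u).
  by have := hc_split u (idm Z ⊚ u); nf.
(* The map [h1] classifying [s] is conjugated back, with [u] inserting [chi ∘ tau] on both sides of
   [Z]. *)
exists (idm (chi ∘ R ∘ tau) ⊙ (idm chi ⊚ h1 ⊚ idm tau)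
  ⊙ (u ⊚ idm Z ⊚ u) ⊙ idm Z); split=> [Y|h hP].
  apply: cl_inj; rewrite !(cl_comp, cl_hcomp) actE; nf.
  rewrite split_u; nf; nf_rewrite (whiskerr tau (h1E (Y ∘ chi))).
  have [f fE] : exists f : hom Y (Y ∘ chi ∘ tau), cl f = '1_Y ⊠ cl u.
    by exists (idm (Y ∘ chi ∘ tau) ⊙ (idm Y ⊚ u) ⊙ idm Y); nf.
  have n : ('1_Y ⊠ cl u) * cl (t Y) = cl (t (Y ∘ chi ∘ tau)) * ('1_Y ⊠ cl u ⊠ '1_Z).
    by have := congr1 (@cl _ _ _ _ _ _) (t_nat _ _ f); rewrite !(cl_comp, cl_hcomp) fE; nf.
  nf_rewrite (esym (whiskerr (chi ∘ tau) n)).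
  nf_rewrite (interchange (t Y) u).
  nf_rewrite (whisker Y tau tri_l).
  by nf_rewrite (whiskerl Y vu).
(* For uniqueness, a solution [h] is sent to [h2], which also classifies [s] and so equals [h1]; the
   triangle identities recover [h] from [h2]. *)
have [h2 h2E] : exists h2 : hom (tau ∘ Z ∘ chi) R,
    cl h2 = (cl w ⊠ '1_R ⊠ cl w) * ('1_tau ⊠ cl h ⊠ '1_chi).
  exists (idm R ⊙ (w ⊚ idm R ⊚ w) ⊙ (idm tau ⊚ h ⊚ idm chi)
            ⊙ idm (tau ∘ Z ∘ chi)).
  by nf.
have split_w : cl w ⊠ '1_R ⊠ cl w
    = (cl w ⊠ '1_R) * ('1_tau ⊠ '1_chi ⊠ '1_R ⊠ cl w).
  by have := hc_split w (idm R ⊚ w); nf.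
have split_w' : cl w ⊠ '1_R ⊠ cl w
    = ('1_R ⊠ cl w) * (cl w ⊠ '1_R ⊠ '1_tau ⊠ '1_chi).
  by rewrite split_w; nf_rewrite (interchange w (idm R ⊚ w)).
have h12 : h1 = h2.
  apply: (universal_action_uniq uni) => W; apply: cl_inj; nf.
  rewrite h1E h2E split_w'; nf.
  nf_rewrite (interchange (beta W) w).
  have [f fE] : exists f : hom (W ∘ tau ∘ chi) W, cl f = '1_W ⊠ cl w.
    by exists (idm W ⊙ (idm W ⊚ w) ⊙ idm (W ∘ tau ∘ chi)); nf.
  have n : ('1_W ⊠ cl w) * cl (beta (W ∘ tau ∘ chi)) = cl (beta W) * ('1_W ⊠ cl w ⊠ '1_R).
    by have := congr1 (@cl _ _ _ _ _ _) (nat _ _ f); rewrite !(cl_comp, cl_hcomp) fE; nf.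
  nf_rewrite (esym (whiskerr (tau ∘ chi) n)).
  have := congr1 (@cl _ _ _ _ _ _) (hP (W ∘ tau)); rewrite !(cl_comp, cl_hcomp) actE; nf.
  rewrite inv_r => n'.
  by nf_rewrite (whiskerr chi (esym n')).
apply: cl_inj; nf; rewrite h12 h2E split_u split_w; nf.
nf_rewrite (esym (interchange u (h ⊚ idm (chi ∘ tau)))).
nf_rewrite (interchange h u).
nf_rewrite (esym (interchange u (idm (chi ∘ R) ⊚ w ⊚ idm tau))).
nf_rewrite (whiskerr (R ∘ tau) tri_l).
by nf_rewrite (whiskerl (chi ∘ R) tri_r).
Qed.

End ConjugateAction.

(* [K], [K1] stand for [F ∘ G] on 0-cells and 1-cells, [e], [w] for [epsilon],
   [omega], and [adj_unit (e c) (w c)] is then [eta c]. *)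
Section ConjugateAlgebra.
Variables (k : fieldType) (B : twocat k) (K : B -> B).
Variables (K1 : forall c d : B, cells c d -> cells (K c) (K d)).
Variables (chi : forall c, cells (K c) c) (tau : forall c, cells c (K c)).
Variables (e : forall c, iso (chi c ∘ tau c) (id1 c)).
Variables (w : forall c, iso (tau c ∘ chi c) (id1 (K c))).
Variables (chi1 : forall (c d : B) (X : cells c d), iso (X ∘ chi c) (chi d ∘ K1 X)).
Variables (tau1 : forall (c d : B) (X : cells c d), iso (K1 X ∘ tau c) (tau d ∘ X)).
Hypothesis w_mod : forall (c d : B) (X : cells c d),
  (cl (w d) ⊠ '1_(K1 X)) * (('1_(tau d) ⊠ cl (chi1 X)) * (cl (tau1 X) ⊠ '1_(chi c)))
  = '1_(K1 X) ⊠ cl (w c).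
Hypothesis e_mod : forall (c d : B) (X : cells c d),
  (cl (e d) ⊠ '1_X) * (('1_(chi d) ⊠ cl (tau1 X)) * (cl (chi1 X) ⊠ '1_(tau c)))
  = '1_X ⊠ cl (e c).

(** The unit is pasted from [e], [bwd w] and [bwd e], and inverses of modifications are
    modifications. *)
Lemma adj_unit_mod (c d : B) (X : cells c d) :
  ('1_(chi d) ⊠ cl (tau1 X)) * ((cl (chi1 X) ⊠ '1_(tau c))
    * ('1_X ⊠ cl (adj_unit (e c) (w c))))
  = cl (adj_unit (e d) (w d)) ⊠ '1_X.
Proof.
rewrite !cl_adj_unit; nf.
nf_rewrite (whiskerr (chi c ∘ tau c) (esym (e_mod X))).
nf_rewrite (esym (interchange (e d) (chi1 X ⊚ idm (tau c)))).
nf_rewrite (esym (interchange (e d) (idm (chi d) ⊚ tau1 X))).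
nf_rewrite (interchange (chi1 X) (bwd (w c) ⊚ idm (tau c))).
have w_mod' : ('1_(tau d) ⊠ cl (chi1 X)) * ((cl (tau1 X) ⊠ '1_(chi c))
    * ('1_(K1 X) ⊠ cl (bwd (w c)))) = cl (bwd (w d)) ⊠ '1_(K1 X).
  cancel_iso (iso_hcomp (w d) (iso_id (K1 X))); nf; nf_rewrite (w_mod X).
  nf_rewrite (whiskerl (K1 X) (iso_vcVK (w c))).
  by nf_rewrite (whiskerr (K1 X) (iso_vcVK (w d))).
nf_rewrite (whisker (chi d) (tau c) w_mod').
nf_rewrite (whiskerl (chi d) (esym (interchange (bwd (w d)) (tau1 X)))).
have e_mod' : ('1_(chi d) ⊠ cl (tau1 X)) * ((cl (chi1 X) ⊠ '1_(tau c))
    * ('1_X ⊠ cl (bwd (e c)))) = cl (bwd (e d)) ⊠ '1_X.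
  cancel_iso (iso_hcomp (e d) (iso_id X)); nf; nf_rewrite (e_mod X).
  nf_rewrite (whiskerl X (iso_vcVK (e c))).
  by nf_rewrite (whiskerr X (iso_vcVK (e d))).
by rewrite e_mod'.
Qed.

Lemma adj_unit_inv_mod (c d : B) (X : cells c d) :
  ('1_X ⊠ cl (adj_unit_inv (e c) (w c)))
    * ((cl (bwd (chi1 X)) ⊠ '1_(tau c)) * ('1_(chi d) ⊠ cl (bwd (tau1 X))))
  = cl (adj_unit_inv (e d) (w d)) ⊠ '1_X.
Proof.
have := adj_unit_mod X; have := adj_unitK (e c) (w c); have := adj_unitVK (e d) (w d).
move: (adj_unit _ _) (adj_unit_inv _ _) (adj_unit _ _) (adj_unit_inv _ _).
move=> u v u' v' u'v' vu M.
move: (congr1 (fun p => ('1_X ⊠ cl v) * ((cl (bwd (chi1 X)) ⊠ '1_(tau c))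
  * (('1_(chi d) ⊠ cl (bwd (tau1 X))) * (p * (cl v' ⊠ '1_X))))) M); nf.
nf_rewrite (whiskerr X u'v').
nf_rewrite (whiskerl (chi d) (iso_vcK (tau1 X))).
nf_rewrite (whiskerr (tau c) (iso_vcK (chi1 X))).
by nf_rewrite (whiskerl X vu); move=> <-.
Qed.

Variables (R : forall c, cells (K c) (K c)) (d0 : B).
Variable beta : forall c (W : cells (K c) d0), hom (W ∘ R c) W.
Hypothesis beta_univ : forall c, universal_action (@beta c).
Variable s : forall (c d : B) (X : cells c d), hom (R d ∘ K1 X) (K1 X ∘ R c).
Hypothesis beta_s : forall (c d : B) (X : cells c d) (W : cells (K d) d0),
  cl (beta W) ⊠ '1_(K1 X) = cl (beta (W ∘ K1 X)) * ('1_W ⊠ cl (s X)).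
Variable m : forall c, hom (R c ∘ R c) (R c).
Hypothesis beta_m : forall c (W : cells (K c) d0),
  cl (beta W) * ('1_W ⊠ cl (m c)) = cl (beta W) * (cl (beta W) ⊠ '1_(R c)).
Variable u : forall c, hom (id1 (K c)) (R c).
Hypothesis beta_u : forall c (W : cells (K c) d0),
  cl (beta W) * ('1_W ⊠ cl (u c)) = '1_W.

Variable sigma : forall (c d : B) (X : cells c d),
  hom (chi d ∘ R d ∘ tau d ∘ X) (X ∘ (chi c ∘ R c ∘ tau c)).
Hypothesis sigmaE : forall (c d : B) (X : cells c d),
  cl (sigma X) = (cl (bwd (chi1 X)) ⊠ '1_(R c) ⊠ '1_(tau c))
    * (('1_(chi d) ⊠ cl (s X) ⊠ '1_(tau c))
       * ('1_(chi d) ⊠ '1_(R d) ⊠ cl (bwd (tau1 X)))).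
Variable mul : forall c,
  hom (chi c ∘ R c ∘ tau c ∘ (chi c ∘ R c ∘ tau c)) (chi c ∘ R c ∘ tau c).
Hypothesis mulE : forall c, cl (mul c) = ('1_(chi c) ⊠ cl (m c) ⊠ '1_(tau c))
  * ('1_(chi c) ⊠ '1_(R c) ⊠ cl (w c) ⊠ '1_(R c) ⊠ '1_(tau c)).
Variable unit : forall c, hom (id1 c) (chi c ∘ R c ∘ tau c).
Hypothesis unitE : forall c, cl (unit c)
  = ('1_(chi c) ⊠ cl (u c) ⊠ '1_(tau c)) * cl (adj_unit (e c) (w c)).

Lemma conj_adjoint_action :
  adjoint_action (S := @CalgData k B (HbData sigma) mul unit)
    (fun c => conj_act (e c) (w c) (@beta c)).
Proof.
have beta_nat (c : B) (W W' : cells (K c) d0) (f : hom W W') :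
    cl f * cl (beta W) = cl (beta W') * (cl f ⊠ '1_(R c)).
  by have [nat _] := @beta_univ c; rewrite -cl_comp nat; nf.
split=> [c|c d X Y|c Y|c Y] /=.
- exact: conj_act_universal.
- rewrite !cl_conj_act sigmaE.
  have := adj_unit_inv_mod X.
  move: (adj_unit_inv _ _) (adj_unit_inv _ _) => v v' M; nf.
  (* Naturality of [beta] along [f] moves [bwd (chi1 X)] past the action, so that [beta_s] applies;
     [M] absorbs the remaining cells. *)
  have [f fE] : exists f : hom (Y ∘ chi c ∘ K1 X) (Y ∘ X ∘ chi d),
      cl f = '1_Y ⊠ cl (bwd (chi1 X)).
    exists (idm (Y ∘ X ∘ chi d) ⊙ (idm Y ⊚ bwd (chi1 X))
              ⊙ idm (Y ∘ chi c ∘ K1 X)).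
    by nf.
  have := beta_nat _ _ _ f; rewrite fE => n.
  nf_rewrite (esym (whiskerr (tau d) n)).
  nf_rewrite (esym (whiskerr (tau d) (beta_s X (Y ∘ chi c)))).
  nf_rewrite (interchange (beta (Y ∘ chi c)) (bwd (tau1 X))).
  by nf_rewrite (whiskerl Y M).
- rewrite !cl_conj_act mulE.
  (* [M] trades the [w] in the multiplication for the [v] that ends the first of two successive
     actions. *)
  have := adj_inv_l (e c) (w c); move: (adj_unit_inv _ _) => v M; nf.
  nf_rewrite (whiskerr (tau c) (beta_m (Y ∘ chi c))).
  nf_rewrite (interchange (beta (Y ∘ chi c)) (w c ⊚ idm (R c) ⊚ idm (tau c))).
  by nf_rewrite (whisker Y (R c ∘ tau c) M).
rewrite cl_conj_act unitE; have := adj_unitK (e c) (w c).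
move: (adj_unit_inv _ _) (adj_unit _ _) => v v' M; nf.
nf_rewrite (whiskerr (tau c) (beta_u (Y ∘ chi c))).
by nf_rewrite (whiskerl Y M).
Qed.

End ConjugateAlgebra.

(** * The action of the image algebra, and the comparison of adjoint algebras *)

Lemma Fhat_adjoint_action (k : fieldType) (B B' : twocat k) (F : pf_data B B')
    (Fpf : is_pseudofunctor F) (G : quasi_inverse F) (b : B) (S : calg_data B)
    (act : forall (a : B) (Y : cells a b), hom (Y ∘ S a) Y) :
  adjoint_action act ->
  exists act' : forall (c : B') (Y : cells c (F b)), hom (Y ∘ Fhat_alg G S c) Y,
    adjoint_action act'.
Proof.
case=> act_univ act_hb act_mul act_unit.
have [Ffaith Ffull Fsurj] := biequivalence_local G.
have [beta [beta_nat betaF]] :=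
  transported_natural_action Fpf Ffull Fsurj act_univ.
exists (fun c => conj_act (qi_epsilon G c) (qi_omega G c) (beta (G c))).
apply: (@conj_adjoint_action k B' (fun c => F (G c))
  (fun c d X => pf1 F (pf1 G X)) (fun c => qi_chi G c) (fun c => qi_tau G c)
  (fun c => qi_epsilon G c) (fun c => qi_omega G c)
  (fun c d X => pn1 (qi_chi G) X) (fun c d X => pn1 (qi_tau G) X) _ _
  (fun c => pf1 F (S (G c))) (F b) (fun c => beta (G c)) _
  (fun c d X => bwd (alpha F (pf1 G X) (S (G c)))
    • (fmap (pf1 F) (hb1 S (pf1 G X)) • alpha F (S (G d)) (pf1 G X)))
  _
  (fun c => fmap (pf1 F) (calg_mul S (G c)) • alpha F (S (G c)) (S (G c)))
  _
  (fun c => fmap (pf1 F) (calg_unit S (G c)) • phi F (G c)) _).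
- move=> c d X.
  have := congr1 (@cl _ _ _ _ _ _) (@qi_omegaP _ _ _ _ G _ _ X).
  rewrite !cl_comp /=; nf.
  exact.
- move=> c d X.
  have := congr1 (@cl _ _ _ _ _ _) (@qi_epsilonP _ _ _ _ G _ _ X).
  by rewrite !cl_comp /=; nf.
- by move=> c; apply: (transported_universal_action Fpf Ffaith Ffull Fsurj act_univ).
- move=> c d X W.
  rewrite (transported_braid Fpf Fsurj beta_nat betaF
    (hb := fun a c X => hb1 S X)) //.
  by rewrite !cl_comp.
- move=> c W; rewrite cl_comp.
  exact: (transported_mul Fpf Fsurj beta_nat betaF act_mul).
- move=> c W; rewrite cl_comp.
  exact: (transported_unit Fpf Fsurj beta_nat betaF act_unit).
- by move=> c d X; nf.
- by move=> c; nf.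
- by move=> c; rewrite /Fhat_unit /eta /adj_unit; nf.
Qed.

Theorem theorem5p9 (k : closedFieldType) (B B' : twocat k)
    (B_finite : finite_2cat B) (B'_finite : finite_2cat B')
    (D : forall (a b : B) (X : cells a b), dual_data X)
    (D_dual : forall (a b : B) (X : cells a b), is_left_dual (D a b X))
    (D' : forall (a b : B') (X : cells a b), dual_data X)
    (D'_dual : forall (a b : B') (X : cells a b), is_left_dual (D' a b X))
    (F : pf_data B B') (F_2functor : is_2functor F) (G : quasi_inverse F)
    (b : B) (Ad_b : calg_data B) (Ad_Fb : calg_data B') :
  is_adjoint_algebra D b Ad_b ->
  is_adjoint_algebra D' (F b) Ad_Fb ->
  isomorphic_center_algebras (Fhat_alg G Ad_b) Ad_Fb.
Proof.
move=> Adb AdFb; have [Fpf _ _] := F_2functor.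
have [act act_adj] := adjoint_algebra_action D_dual Adb.
have [act' act'_adj] := Fhat_adjoint_action Fpf G act_adj.
have [actF actF_adj] := adjoint_algebra_action D'_dual AdFb.
by apply (adjoint_action_unique D'_dual act'_adj actF_adj (proj1 AdFb)).
Qed.
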